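(* Let $V$ be a unitary vertex operator algebra of CFT type which is $C_2$-cofinite and such that every $\mathbb N$-gradable weak $V$-module is completely reducible. Let $W_i,W_j,W_k$ be unitary $V$-modules, and let $\mathcal Y_\alpha\in\mathcal V{k\choose i~j}$. (a) Suppose that $V$ is generated by a set $E$ of homogeneous vectors. If for each $v\in E$, $Y_i(v,x)$ is energy-bounded, then $Y_i$ is energy-bounded. (b) If $W_i$ is irreducible, $Y_j,Y_k$ are energy-bounded, and there exists a nonzero homogeneous vector $w^{(i)}\in W_i$ such that $\mathcal Y_\alpha(w^{(i)},x)$ is energy-bounded, then $\mathcal Y_\alpha$ is energy-bounded. (c) If $w^{(i)}\in W_i$ is homogeneous and $\mathcal Y_\alpha(w^{(i)},x)$ is energy-bounded, then $\mathcal Y_{C^{\pm1}\alpha}(w^{(i)},x)$, $\mathcal Y_{\overline \alpha}(\overline {w^{(i)}},x)$, and $\mathcal Y_{\alpha^*}(\overline{w^{(i)}},x)$ are energy-bounded. (d) If $w^{(i)}\in W_i$ is quasi-primary and $\mathcal Y_\alpha(w^{(i)},x)$ satisfies $r$-th order energy bounds, then $\mathcal Y_{C^{\pm1}\alpha}(w^{(i)},x)$, $\mathcal Y_{\overline \alpha}(\overline {w^{(i)}},x)$, and $\mathcal Y_{\alpha^*}(\overline{w^{(i)}},x)$ satisfy $r$-th order energy bounds.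
   Context: VOAs and modules. A VOA $V=\bigoplus_{n\in\mathbb Z}V(n)$ ($\dim V(n)<\infty$, $V(n)=0$ for $n\ll0$) has vertex operators $Y(u,x)=\sum_{n\in\mathbb Z}Y(u,n)x^{-n-1}$, vacuum $\Omega\in V(0)$, conformal vector $\nu\in V(2)$, with the usual axioms. CFT type: $V(0)=\mathbb C\Omega$, $V(n)=0$ for $n<0$. A $V$-module $W_i=\bigoplus_{s\in\mathbb R}W_i(s)$ ($\dim W_i(s)<\infty$, $W_i(s)=0$ for $s\ll0$) has a vertex operator $Y_i(v,x)=\sum_{n\in\mathbb Z}Y_i(v,n)x^{-n-1}$ with the usual axioms, $L_n=Y_i(\nu,n+1)$, $L_0=s$ on $W_i(s)$. A vector in $W_i(s)$ is homogeneous of weight $s$; $\Delta_w$ is the weight of $w$; a homogeneous vector $w$ is quasi-primary if $L_1w=0$. $W_0=V$; $W_{\overline i}=\bigoplus_sW_i(s)^*$ is the contragredient module, $Y_{\overline i}(v,x)=Y_i(e^{xL_1}(-x^{-2})^{L_0}v,x^{-1})^{\mathrm t}$. $V$ is generated by $E$ if $V$ is spanned by the vectors $Y(v_1,n_1)\cdots Y(v_m,n_m)\Omega$ with $v_a\in E$, $n_a\in\mathbb Z$. $C_2$-cofinite: $\dim V/\mathrm{span}\{Y(u,-2)v\}<\infty$. An $\mathbb N$-gradable weak module is a space with vertex operator satisfying the module axioms except those on the $L_0$-grading, admitting a grading $\bigoplus_{n\in\mathbb N}W(n)$ with $Y(v,m)W(n)\subset W(n+\Delta_v-m-1)$. Unitarity.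 Inner products are antilinear in the second variable. $V$ is unitary if it has an inner product with $\langle\Omega|\Omega\rangle=1$ and an antilinear automorphism $\theta$ (fixing $\Omega,\nu$) such that $\langle Y(v,x)v_1|v_2\rangle=\langle v_1|Y(e^{xL_1}(-x^{-2})^{L_0}\theta v,x^{-1})v_2\rangle$. A $V$-module $W_i$ with an inner product is unitary if the same holds with $Y_i$ (same $\theta$). For unitary $W_i$, $C_i:W_i\to W_{\overline i}$, $C_iw=\overline w$, is the antilinear bijection with $\langle C_iw_1,w_2\rangle=\langle w_2|w_1\rangle$; $W_{\overline i}$ is given the inner product making $C_i$ antiunitary. Intertwining operators. $\mathcal V{k\choose i~j}$ is the space of type $k\choose i~j$ intertwining operators: linear maps $w^{(i)}\in W_i\mapsto\mathcal Y_\alpha(w^{(i)},x)=\sum_{s\in\mathbb R}\mathcal Y_\alpha(w^{(i)},s)x^{-s-1}$, $\mathcal Y_\alpha(w^{(i)},s)\in\mathrm{Hom}(W_j,W_k)$, with lower truncation, $L_{-1}$-derivative property $\frac d{dx}\mathcal Y_\alpha(w,x)=\mathcal Y_\alpha(L_{-1}w,x)$, and Jacobi identity $\sum_{l\ge0}{m\choose l}\mathcal Y_\alpha(Y_i(u,n+l)w,m+s-l)=\sum_{l\ge0}(-1)^l{n\choose l}Y_k(u,m+n-l)\mathcal Y_\alpha(w,s+l)-\sum_{l\ge0}(-1)^{l+n}{n\choose l}\mathcal Y_\alpha(w,n+s-l)Y_j(u,m+l)$ ($u\in V$, $m,n\in\mathbb Z$, $s\in\mathbb R$). Note $Y_i\in\mathcal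 V{i\choose0~i}$. From $\mathcal Y_\alpha$ one defines: $\mathcal Y_{C^{\pm1}\alpha}\in\mathcal V{\overline j\choose i~\overline k}$ by $\mathcal Y_{C^{\pm1}\alpha}(w^{(i)},x)=\mathcal Y_\alpha(e^{xL_1}(e^{\mp i\pi}x^{-2})^{L_0}w^{(i)},x^{-1})^{\mathrm t}$ (transpose); $\mathcal Y_{\overline\alpha}\in\mathcal V{\overline k\choose\overline i~\overline j}$ by $\mathcal Y_{\overline\alpha}(\overline{w^{(i)}},x)=C_k\mathcal Y_\alpha(w^{(i)},x)C_j^{-1}$; $\mathcal Y_{\alpha^*}=\mathcal Y_{\overline{C\alpha}}\in\mathcal V{j\choose\overline i~k}$, i.e. $\mathcal Y_{\alpha^*}(\overline{w^{(i)}},x)=\mathcal Y_\alpha(e^{xL_1}(e^{-i\pi}x^{-2})^{L_0}w^{(i)},x^{-1})^\dagger$ (formal adjoint). Energy bounds. For a unitary module and $r\in\mathbb R$, $\|w\|_r=\|(1+L_0)^rw\|$. For homogeneous $w^{(i)}\in W_i$ and $r\ge0$, $\mathcal Y_\alpha(w^{(i)},x)$ satisfies $r$-th order energy bounds if there are $M,t\ge0$ such that $\|\mathcal Y_\alpha(w^{(i)},s)w^{(j)}\|\le M(1+|s|)^t\|w^{(j)}\|_r$ for all $s\in\mathbb R$, $w^{(j)}\in W_j$. $\mathcal Y_\alpha(w^{(i)},x)$ is energy-bounded if it satisfies energy bounds of some order; $\mathcal Y_\alpha$ (e.g. $Y_i$) is energy-bounded if $\mathcal Y_\alpha(w^{(i)},x)$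 is energy-bounded for every homogeneous $w^{(i)}$ in its charge space. *)

(* Defs.v *)
From HB Require Import structures.
From mathcomp Require Import all_boot all_order all_algebra.
From mathcomp Require Import all_classical all_reals all_analysis.
From mathcomp Require Import complex.

Set Implicit Arguments.
Unset Strict Implicit.
Unset Printing Implicit Defensive.

Import Order.TTheory GRing.Theory Num.Theory.

Local Open Scope classical_set_scope.
Local Open Scope ring_scope.

(* Conventions.
   - The complex field is R[i] for R : realType.
   - A formal series sum_s A(s) x^(-s-1) is given by its modes s |-> A(s), and
     identities between series are stated mode by mode.
   - "\sum_(i \in A) F i" is the finitely supported sum of fsbigop; it is 0 when
     the support is infinite.  Every sum below has finite support under the axioms
     in force where it is used (finitely many homogeneous components, lower
     truncation, nilpotency of L_1 on a vector). *)

Section LinearAlgebra.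
Variables (K : fieldType) (W : lmodType K).

Definition subspace (U : set W) : Prop :=
  U 0 /\ forall (a : K) u v, U u -> U v -> U (a *: u + v).

Definition lspan (A : set W) : set W :=
  [set w | forall U, subspace U -> A `<=` U -> U w].

Definition finite_dim (U : set W) : Prop := exists s : seq W, U `<=` lspan [set` s].

Definition finite_codim (U : set W) : Prop :=
  exists s : seq W, lspan (U `|` [set` s]) = setT.

(* A direct sum decomposition W = (+)_d W(d) is given by its projections: [pr d] is
   the projection onto W(d) along the other summands, so that
   W(d) = range (pr d) = {w | pr d w = w}. *)
Definition direct_sum_decomposition (I : choiceType) (pr : I -> W -> W) : Prop :=
  [/\ forall d, linear (pr d),
      forall d d' w, pr d (pr d' w) = if d == d' then pr d w else 0,
      forall w, finite_set [set d | pr d w != 0] &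
      forall w, w = \sum_(d \in [set: I]) pr d w].

Definition component (I : choiceType) (pr : I -> W -> W) (d : I) : set W :=
  [set w | pr d w = w].

Definition homogeneous (I : choiceType) (pr : I -> W -> W) (w : W) : Prop :=
  exists d, component pr d w.

Definition truncated_grading (I : numDomainType) (pr : I -> W -> W) : Prop :=
  [/\ direct_sum_decomposition pr,
      forall d, finite_dim (component pr d) &
      exists N : I, forall d, d < N -> component pr d = [set 0]].

End LinearAlgebra.

Section Modes.
Variable R : realType.
Local Notation C := R[i].

Definition binz (m : int) (l : nat) : C :=
  (\prod_(i < l) (m - i%:Z)%:~R) / (l`!)%:R.

(* [I] is int for vertex operators and R for intertwining operators; [V] is the
   space whose vertex operators [Yi], [Yj], [Yk] act on [Wi], [Wj], [Wk]. *)
Definition jacobi (I : pzRingType) (V Wi Wj Wk : lmodType C)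
    (Yi : V -> int -> Wi -> Wi) (Yj : V -> int -> Wj -> Wj)
    (Yk : V -> int -> Wk -> Wk) (y : Wi -> I -> Wj -> Wk) : Prop :=
  forall (u : V) (m n : int) (s : I) (w : Wi) (wj : Wj),
    \sum_(l \in [set: nat])
       binz m l *: y (Yi u (n + l%:Z) w) (m%:~R + s - l%:R) wj
  = \sum_(l \in [set: nat])
       ((-1) ^+ l * binz n l) *: Yk u (m + n - l%:Z) (y w (s + l%:R) wj)
  - \sum_(l \in [set: nat])
       ((-1) ^ (l%:Z + n) * binz n l) *:
         y w (n%:~R + s - l%:R) (Yj u (m + l%:Z) wj).

Definition bilinear_modes (I : Type) (Wi Wj Wk : lmodType C)
    (y : Wi -> I -> Wj -> Wk) : Prop :=
  (forall w s, linear (y w s)) /\ (forall s wj, linear (fun w => y w s wj)).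

Definition lower_truncated (I : numDomainType) (Wi Wj Wk : lmodType C)
    (y : Wi -> I -> Wj -> Wk) : Prop :=
  forall w wj, exists N : I, forall s, N <= s -> y w s wj = 0.

(* Modes of y(e^{x L_1} phase x^{-2 L_0} w, 1/x), where phase stands for the action
   of the scalar [phase d] in weight d: for w of weight d, the coefficient of
   x^{-s-1} is  phase d * sum_l (1/l!) y(L_1^l w, 2d - l - s - 2). *)
Definition opposite_modes (I : numDomainType) (Wi Wj Wk : lmodType C)
    (pr : I -> Wi -> Wi) (L1 : Wi -> Wi) (phase : I -> C)
    (y : Wi -> I -> Wj -> Wk) (w : Wi) (s : I) (wj : Wj) : Wk :=
  \sum_(d \in [set: I]) \sum_(l \in [set: nat])
     (phase d / (l`!)%:R) *: y (iter l L1 (pr d w)) (2 * d - l%:R - s - 2) wj.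

(* (-1)^{L_0} on an integrally graded space *)
Definition sign_phase (d : int) : C := (-1) ^ d.

(* (e^{-i pi})^{L_0} for [plus = true], (e^{i pi})^{L_0} for [plus = false] *)
Definition pi_phase (plus : bool) (d : R) : C :=
  let t := if plus then - (pi * d) else pi * d in Complex (cos t) (sin t).

End Modes.

Section VOA.
Variable R : realType.
Local Notation C := R[i].

Record voaData := VoaData {
  voa_car :> lmodType C;
  voa_pr : int -> voa_car -> voa_car;
  voa_Y : voa_car -> int -> voa_car -> voa_car;
  vac : voa_car;
  conf : voa_car }.

Definition vL (V : voaData) (n : int) : V -> V := voa_Y (conf V) (n + 1).

Record is_voa (V : voaData) : Prop := {
  voa_grading : truncated_grading (@voa_pr V);
  voa_bilinear : bilinear_modes (@voa_Y V);
  voa_truncated : lower_truncated (@voa_Y V);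
  voa_vac_weight : component (@voa_pr V) 0 (vac V);
  voa_conf_weight : component (@voa_pr V) 2 (conf V);
  voa_vacuum : forall (n : int) (v : V), voa_Y (vac V) n v = if n == -1 then v else 0;
  voa_creation : forall (v : V), voa_Y v (-1) (vac V) = v /\
    forall n : int, 0 <= n -> voa_Y v n (vac V) = 0;
  voa_virasoro : exists c : C, forall (m n : int) (v : V),
    vL m (vL n v) - vL n (vL m v) = (m - n)%:~R *: vL (m + n) v +
      (if m + n == 0 then (c / 12 * (m ^+ 3 - m)%:~R) *: v else 0);
  voa_L0 : forall (n : int) (v : V), component (@voa_pr V) n v -> vL 0 v = n%:~R *: v;
  voa_derivative : forall (v : V) (n : int) (u : V),
    voa_Y (vL (-1) v) n u = - (n%:~R *: voa_Y v (n - 1) u);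
  voa_jacobi : jacobi (@voa_Y V) (@voa_Y V) (@voa_Y V) (@voa_Y V) }.

Definition cft_type (V : voaData) : Prop :=
  component (@voa_pr V) 0 = [set a *: vac V | a in [set: C]] /\
  forall n, n < 0 -> component (@voa_pr V) n = [set 0].

Definition c2_cofinite (V : voaData) : Prop :=
  finite_codim (lspan [set voa_Y u (-2) v | u in [set: V] & v in [set: V]]).

Definition generated_by (V : voaData) (E : set V) : Prop :=
  lspan [set w | exists2 p : seq (V * int), (forall q, q \in p -> E q.1) &
           w = foldr (fun q u => voa_Y q.1 q.2 u) (vac V) p] = setT.

(* The module axioms other than those on the L_0-grading. *)
Record is_weak_module (V : voaData) (W : lmodType C) (Y : V -> int -> W -> W) :
    Prop := {
  mod_bilinear : bilinear_modes Y;
  mod_truncated : lower_truncated Y;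
  mod_vacuum : forall n w, Y (vac V) n w = if n == -1 then w else 0;
  mod_derivative : forall v n w, Y (vL (-1) v) n w = - (n%:~R *: Y v (n - 1) w);
  mod_jacobi : jacobi (@voa_Y V) Y Y Y }.

Section Submodules.
Variables (V : voaData) (W : lmodType C) (Y : V -> int -> W -> W).

Definition submodule (U : set W) : Prop :=
  subspace U /\ forall v n u, U u -> U (Y v n u).

Definition irreducible_submodule (U : set W) : Prop :=
  [/\ submodule U, U <> [set 0] &
      forall U', submodule U' -> U' `<=` U -> U' = [set 0] \/ U' = U].

(* W is the internal direct sum of a family of irreducible submodules. *)
Definition completely_reducible : Prop :=
  exists F : set (set W),
    [/\ forall U, F U -> irreducible_submodule U,
        lspan (\bigcup_(U in F) U) = setT &
        forall U, F U -> U `&` lspan (\bigcup_(U' in F `\ U) U') = [set 0]].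

(* An N-grading is a Z-grading whose components of negative degree vanish. *)
Definition N_gradable : Prop :=
  exists pr : int -> W -> W,
    [/\ direct_sum_decomposition pr,
        forall n, n < 0 -> component pr n = [set 0] &
        forall d (v : V) (m n : int) w, component (@voa_pr V) d v ->
          component pr n w -> component pr (n + d - m - 1) (Y v m w)].

End Submodules.

Definition N_gradable_modules_completely_reducible (V : voaData) : Prop :=
  forall (W : lmodType C) (Y : V -> int -> W -> W),
    is_weak_module Y -> N_gradable Y -> completely_reducible Y.

End VOA.

Section Modules.
Variables (R : realType) (V : voaData R).
Local Notation C := R[i].

Record modData := ModData {
  mod_car :> lmodType C;
  mod_pr : R -> mod_car -> mod_car;
  mod_Y : V -> int -> mod_car -> mod_car }.

Definition mL (W : modData) (n : int) : W -> W := mod_Y (conf V) (n + 1).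

Record is_module (W : modData) : Prop := {
  mod_weak : is_weak_module (@mod_Y W);
  mod_grading : truncated_grading (@mod_pr W);
  mod_L0 : forall s w, component (@mod_pr W) s w -> mL 0 w = (s%:C)%C *: w }.

Definition irreducible_module (W : modData) : Prop :=
  irreducible_submodule (@mod_Y W) setT.

Definition quasi_primary (W : modData) (w : W) : Prop :=
  homogeneous (@mod_pr W) w /\ mL 1 w = 0.

(* The graded dual (+)_s W(s)^*: the functionals vanishing on all but finitely many
   of the W(s). *)
Definition in_graded_dual (W : modData) (f : W -> C^o) : Prop :=
  scalar f /\ finite_set [set s | exists w, f (mod_pr s w) != 0].

Definition graded_dual_pred (W : modData) : {pred (W -> C^o)} :=
  fun f => `[< in_graded_dual f >].

Record graded_dual (W : modData) := GradedDual {
  gd_fun :> W -> C^o;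
  _ : gd_fun \in @graded_dual_pred W }.

HB.instance Definition _ (W : modData) := [isSub of graded_dual W for @gd_fun W].
HB.instance Definition _ (W : modData) := [Choice of graded_dual W by <:].

Lemma graded_dual_closed (W : modData) : submod_closed (@graded_dual_pred W).
Proof.
split=> [|a f g].
  apply/asboolP; split.
    by move=> k u v; rewrite -[LHS]/(0 : C) -[RHS]/(k * 0 + 0 : C) mulr0 addr0.
  by rewrite [X in finite_set X](_ : _ = set0) //; apply/seteqP; split=> // s [w];
     rewrite eqxx.
move=> /asboolP[flin ffin] /asboolP[glin gfin]; apply/asboolP; split.
  move=> k u v.
  rewrite -[LHS]/(a * f (k *: u + v) + g (k *: u + v) : C) flin glin.
  rewrite -[RHS]/(k * (a * f u + g u) + (a * f v + g v) : C).
  by rewrite !mulrDr !mulrA [k * a]mulrC -!addrA; congr (_ + _); rewrite addrCA.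
apply: (@sub_finite_set _ _ ([set s | exists w, f (mod_pr s w) != 0] `|`
  [set s | exists w, g (mod_pr s w) != 0])); last by rewrite finite_setU.
move=> s [w fg0] /=.
have [f0|f0] := eqVneq (f (mod_pr s w)) 0; last by left; exists w.
right; exists w; apply: contraNneq fg0 => g0.
by rewrite -[X in X == _]/(a * f (mod_pr s w) + g (mod_pr s w) : C) f0 g0 mulr0 addr0.
Qed.

HB.instance Definition _ (W : modData) :=
  GRing.isSubmodClosed.Build C (W -> C^o) (@graded_dual_pred W)
    (@graded_dual_closed W).
HB.instance Definition _ (W : modData) :=
  [SubChoice_isSubLmodule of graded_dual W by <:].

(* The transpose of A : W1 -> W2 as an operator between graded duals.  The default
   value 0 of [insubd] is taken only if f \o A is not in the graded dual; this does
   not happen when A is a weight projection, or comes from a vertex or intertwining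
   operator: on each weight space such an A is a finite sum of maps shifting the
   weight by a constant. *)
Definition transpose (W1 W2 : modData) (A : W1 -> W2) (f : graded_dual W2) :
    graded_dual W1 :=
  insubd 0 (f \o A : W1 -> C^o).

Definition contragredient (W : modData) : modData :=
  @ModData (graded_dual W) (fun s => transpose (@mod_pr W s))
    (fun v n => transpose
       (opposite_modes (@voa_pr _ V) (vL 1) (@sign_phase R) (@mod_Y W) v n)).

End Modules.

Section Unitarity.
Variable R : realType.
Local Notation C := R[i].

(* Inner products are antilinear in the second variable.  The order of R[i] only
   relates complex numbers with equal imaginary parts, so [0 <= ip w w] includes
   that [ip w w] is real. *)
Definition inner_product (W : lmodType C) (ip : W -> W -> C) : Prop :=
  [/\ forall v, scalar (fun u => ip u v : C^o),
      forall u v, ip v u = (ip u v)^*%C,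
      forall w, 0 <= ip w w &
      forall w, ip w w = 0 -> w = 0].

Definition antilinear (U W : lmodType C) (f : U -> W) : Prop :=
  forall (a : C) u v, f (a *: u + v) = a^*%C *: f u + f v.

Record antilinear_automorphism (V : voaData R) (theta : V -> V) : Prop := {
  theta_bij : bijective theta;
  theta_antilinear : antilinear theta;
  theta_vac : theta (vac V) = vac V;
  theta_conf : theta (conf V) = conf V;
  theta_Y : forall (u : V) n (v : V),
    theta (voa_Y u n v) = voa_Y (theta u) n (theta v) }.

(* <Y(v,x)w1|w2> = <w1|Y(e^{x L_1}(-x^{-2})^{L_0} theta v, 1/x)w2> *)
Definition unitary_modes (V : voaData R) (theta : V -> V) (W : lmodType C)
    (ip : W -> W -> C) (Y : V -> int -> W -> W) : Prop :=
  forall v n w1 w2,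
    ip (Y v n w1) w2 =
    ip w1 (opposite_modes (@voa_pr _ V) (vL 1) (@sign_phase R) Y (theta v) n w2).

Record unitary_voa (V : voaData R) (ip : V -> V -> C) (theta : V -> V) : Prop := {
  uvoa_inner : inner_product ip;
  uvoa_vac : ip (vac V) (vac V) = 1;
  uvoa_theta : antilinear_automorphism theta;
  uvoa_unitary : unitary_modes theta ip (@voa_Y _ V) }.

Variable V : voaData R.

Record umodData := UModData {
  umod_mod :> modData V;
  umod_ip : umod_mod -> umod_mod -> C }.

Record unitary_module (theta : V -> V) (W : umodData) : Prop := {
  umod_module : is_module W;
  umod_inner : inner_product (@umod_ip W);
  umod_unitary : unitary_modes theta (@umod_ip W) (@mod_Y _ _ W) }.

(* C_W w = <.|w>; the default value 0 of [insubd] is not taken on a unitary module,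
   whose weight spaces are orthogonal. *)
Definition conj_map (W : umodData) (w : W) : graded_dual W :=
  insubd 0 ((fun u => umod_ip u w) : W -> C^o).

Definition conj_inv (W : umodData) (f : graded_dual W) : W :=
  xget 0 [set w | conj_map w = f].

(* The inner product making [conj_map] antiunitary. *)
Definition ucontragredient (W : umodData) : umodData :=
  @UModData (contragredient W)
    (fun f g : graded_dual W => umod_ip (conj_inv g) (conj_inv f)).

Definition adjoint (W1 W2 : umodData) (A : W1 -> W2) (w2 : W2) : W1 :=
  xget 0 [set w1 | forall u, umod_ip (A u) w2 = umod_ip u w1].

End Unitarity.

Section Intertwining.
Variables (R : realType) (V : voaData R).
Local Notation C := R[i].

Record intertwining (Wi Wj Wk : modData V) (y : Wi -> R -> Wj -> Wk) : Prop := {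
  itw_bilinear : bilinear_modes y;
  itw_truncated : lower_truncated y;
  itw_derivative : forall w s wj, y (mL (-1) w) s wj = - ((s%:C)%C *: y w (s - 1) wj);
  itw_jacobi : jacobi (@mod_Y _ _ Wi) (@mod_Y _ _ Wj) (@mod_Y _ _ Wk) y }.

(* Y_{C^{+1} alpha} for [plus = true], Y_{C^{-1} alpha} for [plus = false]; of type
   (contragredient Wj; Wi, contragredient Wk). *)
Definition itw_C (plus : bool) (Wi Wj Wk : umodData V) (y : Wi -> R -> Wj -> Wk)
    (w : Wi) (s : R) : ucontragredient Wk -> ucontragredient Wj :=
  transpose (opposite_modes (@mod_pr _ _ Wi) (mL 1) (@pi_phase R plus) y w s).

Definition itw_bar (Wi Wj Wk : umodData V) (y : Wi -> R -> Wj -> Wk)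
    (f : ucontragredient Wi) (s : R) (g : ucontragredient Wj) : ucontragredient Wk :=
  conj_map (y (conj_inv f) s (conj_inv g)).

Definition itw_adj (Wi Wj Wk : umodData V) (y : Wi -> R -> Wj -> Wk)
    (f : ucontragredient Wi) (s : R) : Wk -> Wj :=
  adjoint (opposite_modes (@mod_pr _ _ Wi) (mL 1) (@pi_phase R true) y
             (conj_inv f) s).

(* The module vertex operator as an R-indexed family: zero at non-integers. *)
Definition real_modes (W : modData V) (v : V) (s : R) (w : W) : W :=
  if s \is a Num.int then mod_Y v (Num.floor s) w else 0.

Definition wnorm (W : umodData V) (w : W) : R := Num.sqrt (complex.Re (umod_ip w w)).

(* ||(1 + L_0)^r w||; L_0 is nonnegative on a unitary module. *)
Definition wnorm_r (W : umodData V) (r : R) (w : W) : R :=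
  wnorm (\sum_(s \in [set: R]) (((1 + s) `^ r)%:C)%C *: mod_pr s w).

(* [A] is the family of modes of one charged field Y_alpha(w, x). *)
Definition energy_bounds (Wj Wk : umodData V) (r : R) (A : R -> Wj -> Wk) : Prop :=
  exists M t : R, [/\ 0 <= M, 0 <= t &
    forall s wj, wnorm (A s wj) <= M * (1 + `|s|) `^ t * wnorm_r r wj].

Definition energy_bounded (Wj Wk : umodData V) (A : R -> Wj -> Wk) : Prop :=
  exists2 r : R, 0 <= r & energy_bounds r A.

Definition itw_energy_bounded (Wi Wj Wk : umodData V) (y : Wi -> R -> Wj -> Wk) :
    Prop :=
  forall w, homogeneous (@mod_pr _ _ Wi) w -> energy_bounded (y w).

Definition mod_energy_bounded (W : umodData V) : Prop :=
  forall v, homogeneous (@voa_pr _ V) v -> energy_bounded (real_modes (W := W) v).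

End Intertwining.

(* Main.v *)
(* All bounds are checked on homogeneous vectors: the modes of a homogeneous field
   shift weights by a constant, distinct weight spaces of a unitary module are
   orthogonal and all weights are nonnegative, so by Parseval a field is energy-bounded
   iff its s-th mode has norm polynomial in (1 + |s|)(1 + t) on weight t.  By the
   Jacobi identity with m = 0 this property passes from Y(u, x) and the field of w to
   the field of Y(u, n) w: since weights are nonnegative, the number of nonzero terms
   is at most linear in (1 + |s|)(1 + t), and the binomial coefficients grow
   polynomially.  This gives (a) and (b).  For (c) and (d), a bound
   |A v| <= K |v|_r for A shifting weights by delta gives
   |A^* v|^2 = <A A^* v | v> <= K |A^* v|_r |v|, hence an r-th order bound on A^*
   with constant K (1 + |delta|)^r; and L_1^l w is energy-bounded whenever w is,
   because L_1 w = Y(nu, 2) w only involves L_1, L_0 and L_-1, which are bounded by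
   L_0 + 1. *)
Require Import Defs.
From mathcomp Require Import all_boot all_order all_algebra.
From mathcomp Require Import all_classical all_reals all_analysis.
From mathcomp Require Import complex.
From mathcomp Require Import ring lra.

Set Implicit Arguments.
Unset Strict Implicit.
Unset Printing Implicit Defensive.

Import Order.TTheory GRing.Theory Num.Theory.

Local Open Scope classical_set_scope.
Local Open Scope ring_scope.

(** * Finitely supported sums, subspaces and spans *)

(* [Defs.subspace] is qualified because MathComp-Analysis has a topological
   [subspace]. *)
Section FiniteSums.
Variables (I : choiceType).

Lemma fsum_seq (M : nmodType) (r : seq I) (F : I -> M) :
  uniq r -> (forall i, i \notin r -> F i = 0) ->
  \sum_(i \in [set: I]) F i = \sum_(i <- r) F i.
Proof.
move=> ur F0; rewrite (fsbigE r)//; last by move=> i _; exact: F0.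
by apply: eq_bigl => i; rewrite in_setT.
Qed.

Lemma fsum_only (M : nmodType) (j : I) (F : I -> M) :
  (forall i, i != j -> F i = 0) -> \sum_(i \in [set: I]) F i = F j.
Proof.
move=> F0; rewrite (@fsum_seq _ [:: j])// ?big_seq1// => i.
by rewrite inE => /F0.
Qed.

Lemma fsum_subspace (K : fieldType) (W : lmodType K) (U : set W) (F : I -> W) :
  Defs.subspace U -> (forall i, U (F i)) -> U (\sum_(i \in [set: I]) F i).
Proof.
move=> [U0 UD] UF; elim/big_ind: _ => // u v Uu Uv.
by rewrite -[u]scale1r; apply: UD.
Qed.

End FiniteSums.

Lemma fsum_nat (M : nmodType) (N : nat) (F : nat -> M) :
  (forall l, (N <= l)%N -> F l = 0) ->
  \sum_(l \in [set: nat]) F l = \sum_(l < N) F l.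
Proof.
move=> F0; rewrite (@fsum_seq _ _ (iota 0 N)) ?iota_uniq//.
  by rewrite -[N in iota 0 N]subn0 big_mkord.
by move=> l; rewrite mem_iota /= -leqNgt; exact: F0.
Qed.

Section Subspaces.
Variables (K : fieldType) (W : lmodType K).
Implicit Types (U A : set W).

Lemma subspace_sum U J (r : seq J) (P : pred J) (F : J -> W) :
  Defs.subspace U -> (forall i, P i -> U (F i)) -> U (\sum_(i <- r | P i) F i).
Proof.
move=> [U0 UD] UF; elim/big_ind: _ => // u v Uu Uv.
by rewrite -[u]scale1r; apply: UD.
Qed.

Lemma subspaceZ U a u : Defs.subspace U -> U u -> U (a *: u).
Proof. by move=> [U0 UD] Uu; rewrite -[_ *: _]addr0; apply: UD. Qed.

Lemma subspaceD U u v : Defs.subspace U -> U u -> U v -> U (u + v).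
Proof. by move=> [U0 UD] Uu Uv; rewrite -[u]scale1r; apply: UD. Qed.

Lemma subspaceB U u v : Defs.subspace U -> U u -> U v -> U (u - v).
Proof. by move=> sU Uu Uv; rewrite -scaleN1r; apply: subspaceD => //; exact: subspaceZ. Qed.

Lemma subspace_lspan A : Defs.subspace (lspan A).
Proof.
split; first by move=> U [].
by move=> a u v Au Av U sU AU; case: (sU) => _; apply; [exact: Au|exact: Av].
Qed.

Lemma sub_lspan A : A `<=` lspan A.
Proof. by move=> w Aw U _; apply. Qed.

Lemma lspan_full_ind A U : lspan A = setT -> Defs.subspace U -> A `<=` U ->
  forall w, U w.
Proof.
move=> A_full sU AU w; have : [set: W] w by [].
by rewrite -A_full => /(_ U sU AU).
Qed.

End Subspaces.

(** * Linear maps given as plain functions with a linearity hypothesis *)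

Section UnbundledLinear.
Variables (K : fieldType) (U W : lmodType K) (f : U -> W).
Hypothesis f_lin : linear f.

Lemma linearP0 : f 0 = 0.
Proof. by have := f_lin (-1) 0 0; rewrite scaler0 addr0 scaleN1r addNr. Qed.

Lemma linearPD u v : f (u + v) = f u + f v.
Proof. by rewrite -{1}[u]scale1r f_lin scale1r. Qed.

Lemma linearPZ a u : f (a *: u) = a *: f u.
Proof. by rewrite -[X in f X]addr0 f_lin linearP0 addr0. Qed.

Lemma linearPN u : f (- u) = - f u.
Proof. by rewrite -scaleN1r linearPZ scaleN1r. Qed.

Lemma linearPB u v : f (u - v) = f u - f v.
Proof. by rewrite linearPD linearPN. Qed.

Lemma linearP_sum J (r : seq J) (P : pred J) (F : J -> U) :
  f (\sum_(i <- r | P i) F i) = \sum_(i <- r | P i) f (F i).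
Proof. exact: (big_morph f linearPD linearP0). Qed.

End UnbundledLinear.

(** * Direct sum decompositions given by their projections *)

Section DirectSum.
Variables (K : fieldType) (W : lmodType K) (I : choiceType) (pr : I -> W -> W).
Hypothesis prP : direct_sum_decomposition pr.

Lemma pr_linear d : linear (pr d). Proof. by case: prP. Qed.

Lemma prD d u v : pr d (u + v) = pr d u + pr d v.
Proof. exact: (linearPD (pr_linear d)). Qed.
Lemma prZ d a u : pr d (a *: u) = a *: pr d u.
Proof. exact: (linearPZ (pr_linear d)). Qed.
Lemma pr0 d : pr d 0 = 0. Proof. exact: (linearP0 (pr_linear d)). Qed.
Lemma pr_sum d J (r : seq J) P (F : J -> W) :
  pr d (\sum_(i <- r | P i) F i) = \sum_(i <- r | P i) pr d (F i).
Proof. exact: (linearP_sum (pr_linear d)). Qed.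

Lemma pr_pr d d' w : pr d (pr d' w) = if d == d' then pr d w else 0.
Proof. by case: prP. Qed.

Lemma component_pr d w : component pr d (pr d w).
Proof. by rewrite /component/= pr_pr eqxx. Qed.

Lemma pr_component_neq d d' w : component pr d' w -> d != d' -> pr d w = 0.
Proof. by move=> <- /negPf dd'; rewrite pr_pr dd'. Qed.

Lemma subspace_component d : Defs.subspace (component pr d).
Proof.
by split=> [|a u v uE vE]; rewrite /component/= ?pr0// prD prZ uE vE.
Qed.

Lemma pr_decomposition w : exists r : seq I,
  [/\ uniq r, forall d, d \notin r -> pr d w = 0 & w = \sum_(d <- r) pr d w].
Proof.
case: prP => _ _ /(_ w) fw sumw.
have /finite_seqP[r rE] := fw.
have out d : d \notin undup r -> pr d w = 0.
  rewrite mem_undup; apply: contraNeq => dw.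
  by have : [set` r] d by rewrite -rE.
exists (undup r); split; [exact: undup_uniq|exact: out|].
by rewrite {1}(sumw w); apply: fsum_seq out; exact: undup_uniq.
Qed.

Lemma pr_eq u v : (forall d, pr d u = pr d v) -> u = v.
Proof.
by move=> uv; case: prP => _ _ _ sumw; rewrite (sumw u) (sumw v); apply: eq_fsbigr.
Qed.

(* An eigenvector is homogeneous as soon as the operator acts on the summands by
   distinct scalars. *)
Lemma eigen_component (f : W -> W) (ev : I -> K) d w : linear f ->
  injective ev -> (forall t u, component pr t u -> f u = ev t *: u) ->
  f w = ev d *: w -> component pr d w.
Proof.
move=> f_lin evI fE fw; apply: pr_eq => t; rewrite pr_pr.
have [//|td] := eqVneq; apply/esym/eqP.
(* [f] acts on each summand by a scalar, hence on the [t]-th projection by [ev t]; comparing with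
   [ev d] makes this projection vanish for [t] different from [d]. *)
have : pr t (f w) = ev t *: pr t w.
  have [r [ur r0 ->]] := pr_decomposition w.
  rewrite (linearP_sum f_lin) !pr_sum /= scaler_sumr; apply: eq_bigr => i _.
  rewrite (fE _ _ (component_pr i w)) prZ pr_pr.
  by case: eqVneq => [->//|_]; rewrite !scaler0.
rewrite fw prZ => /eqP; rewrite -subr_eq0 -scalerBl scaler_eq0 subr_eq0.
by case/orP => // /eqP/evI dt; rewrite dt eqxx in td.
Qed.

End DirectSum.

Local Notation nrm W := (@wnorm _ _ W).
Local Notation hom W := (component (@mod_pr _ _ W)).

(** * Inner products and norms *)

Section Norm.
Variables (R : realType) (V : voaData R) (W : umodData V).
Hypothesis ipP : inner_product (@umod_ip _ _ W).
Local Notation ip := (@umod_ip _ _ W).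

Lemma ip_linear v : linear (fun u => ip u v : R[i]^o).
Proof. by case: ipP => H _ _ _; exact: H. Qed.

Lemma ip_conj u v : ip v u = (ip u v)^*%C. Proof. by case: ipP. Qed.

Lemma ipDl u1 u2 v : ip (u1 + u2) v = ip u1 v + ip u2 v.
Proof. exact: (linearPD (ip_linear v)). Qed.
Lemma ipZl a u v : ip (a *: u) v = a * ip u v.
Proof. exact: (linearPZ (ip_linear v)). Qed.
Lemma ip0l v : ip 0 v = 0.
Proof. exact: (linearP0 (ip_linear v)). Qed.
Lemma ipBl u1 u2 v : ip (u1 - u2) v = ip u1 v - ip u2 v.
Proof. exact: (linearPB (ip_linear v)). Qed.
Lemma ip_suml J (r : seq J) (P : pred J) (F : J -> W) v :
  ip (\sum_(i <- r | P i) F i) v = \sum_(i <- r | P i) ip (F i) v.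
Proof. exact: (linearP_sum (ip_linear v)). Qed.

Lemma ipDr u v1 v2 : ip u (v1 + v2) = ip u v1 + ip u v2.
Proof. by rewrite ip_conj ipDl rmorphD /= -!ip_conj. Qed.
Lemma ipZr a u v : ip u (a *: v) = a^*%C * ip u v.
Proof. by rewrite ip_conj ipZl rmorphM /= -!ip_conj. Qed.
Lemma ip0r v : ip v 0 = 0.
Proof. by rewrite ip_conj ip0l rmorph0. Qed.
Lemma ipBr u v1 v2 : ip u (v1 - v2) = ip u v1 - ip u v2.
Proof. by rewrite ip_conj ipBl rmorphB /= -!ip_conj. Qed.
Lemma ip_sumr J (r : seq J) (P : pred J) (F : J -> W) u :
  ip u (\sum_(i <- r | P i) F i) = \sum_(i <- r | P i) ip u (F i).
Proof.
by rewrite ip_conj ip_suml rmorph_sum; apply: eq_bigr => i _; rewrite /= -ip_conj.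
Qed.

Lemma ip_eq u v : (forall x, ip x u = ip x v) -> u = v.
Proof.
move=> uv; apply/eqP; rewrite -subr_eq0; apply/eqP.
by case: ipP => _ _ _; apply; rewrite ipBr uv subrr.
Qed.

Lemma Re_ip_ge0 w : 0 <= complex.Re (ip w w).
Proof. by case: ipP => _ _ /(_ w) + _; rewrite lecE /= => /andP[]. Qed.

Lemma wnorm_ge0 w : 0 <= nrm W w. Proof. exact: sqrtr_ge0. Qed.

Lemma wnorm_sqr w : nrm W w ^+ 2 = complex.Re (ip w w).
Proof. by rewrite sqr_sqrtr// Re_ip_ge0. Qed.

Lemma ip_wnorm w : ip w w = (nrm W w ^+ 2)%:C%C.
Proof.
case: ipP => _ _ /(_ w) + _; rewrite wnorm_sqr lecE /= => /andP[/eqP].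
by case: (ip w w) => a b /= -> _.
Qed.

Lemma wnorm0 : nrm W 0 = 0.
Proof. by rewrite /wnorm ip0l sqrtr0. Qed.

Lemma wnorm_eq0 w : nrm W w = 0 -> w = 0.
Proof. by move=> w0; case: ipP => _ _ _; apply; rewrite ip_wnorm w0 expr0n. Qed.

Lemma wnorm_gt0 w : w != 0 -> 0 < nrm W w.
Proof.
by move=> w0; rewrite lt_def wnorm_ge0 andbT; apply: contraNneq w0 => /wnorm_eq0->.
Qed.

Lemma wnormZ a w : nrm W (a *: w) = Normc.normc a * nrm W w.
Proof.
apply/eqP; rewrite -(@eqrXn2 _ 2)// ?wnorm_ge0// ?mulr_ge0 ?wnorm_ge0//; last first.
  by case: a => x y; exact: sqrtr_ge0.
rewrite exprMn wnorm_sqr ipZl ipZr mulrA ip_wnorm; case: a => x y /=.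
rewrite (@sqr_sqrtr _ (x ^+ 2 + y ^+ 2)) ?addr_ge0 ?sqr_ge0//; apply/eqP; ring.
Qed.

(** Cauchy-Schwarz for the real part, with g = Re <u|v>: the vector |v|^2 u - g v has squared norm
    |v|^2 (|u|^2 |v|^2 - g^2). The real part is enough for the triangle inequality and for the
    estimate of adjoints. *)
Lemma Re_ip_le u v : complex.Re (ip u v) <= nrm W u * nrm W v.
Proof.
have [->|v0] := eqVneq v 0; first by rewrite ip0r wnorm0 mulr0.
set g := complex.Re _.
have := Re_ip_ge0 ((nrm W v ^+ 2)%:C%C *: u - g%:C%C *: v).
rewrite ipBl !ipBr !ipZl !ipZr !conjc_real !ip_wnorm (ip_conj u v).
rewrite (_ : complex.Re _ = nrm W v ^+ 2 * ((nrm W u * nrm W v) ^+ 2 - g ^+ 2)); last first.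
  by rewrite /g; case: (ip u v) => x y /=; ring.
rewrite pmulr_rge0 ?exprn_gt0 ?wnorm_gt0// subr_ge0.
have [g0 _|g0] := ltP g 0.
  by rewrite (le_trans (ltW g0))// mulr_ge0// wnorm_ge0.
by rewrite ler_pXn2r// ?nnegrE ?mulr_ge0 ?wnorm_ge0.
Qed.

Lemma wnormD u v : nrm W (u + v) <= nrm W u + nrm W v.
Proof.
rewrite -(@ler_pXn2r _ 2)// ?nnegrE ?addr_ge0 ?wnorm_ge0//.
rewrite wnorm_sqr ipDl !ipDr !ip_wnorm (ip_conj u v).
have := Re_ip_le u v; case: (ip u v) => x y /= xle.
by rewrite sqrrD; nra.
Qed.

Lemma wnorm_sum J (r : seq J) (P : pred J) (F : J -> W) :
  nrm W (\sum_(i <- r | P i) F i) <= \sum_(i <- r | P i) nrm W (F i).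
Proof.
elim/big_ind2 : _ => [|u x v y ux vy|//]; first by rewrite wnorm0.
by rewrite (le_trans (wnormD _ _))// lerD.
Qed.

Lemma wnorm_sum_sqr (J : eqType) (r : seq J) (F : J -> W) : uniq r ->
  (forall i j, i != j -> ip (F i) (F j) = 0) ->
  nrm W (\sum_(i <- r) F i) ^+ 2 = \sum_(i <- r) nrm W (F i) ^+ 2.
Proof.
move=> ur Forth; rewrite wnorm_sqr ip_suml (raddf_sum (@complex.Re R)) /=.
apply: eq_big_seq => i ri; rewrite ip_sumr (bigD1_seq i)//= big1; last first.
  by move=> j ji; rewrite Forth// eq_sym.
by rewrite addr0 -wnorm_sqr.
Qed.

End Norm.

(** * Orthogonal gradings, Parseval, and bounds on homogeneous vectors *)

(** What the estimates use of a unitary module; no completeness is assumed. It is established for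
    unitary modules in [unitary_graded_hilbert]. *)
Record graded_hilbert (R : realType) (V : voaData R) (W : umodData V) : Prop := {
  gh_sum : direct_sum_decomposition (@mod_pr _ _ W);
  gh_fin : forall s, finite_dim (hom W s);
  gh_ip : inner_product (@umod_ip _ _ W);
  gh_orth : forall s t u v, hom W s u -> hom W t v -> s != t ->
    @umod_ip _ _ W u v = 0;
  gh_ge0 : forall s w, hom W s w -> w != 0 -> 0 <= s }.

Section GradedNorm.
Variables (R : realType) (V : voaData R) (W : umodData V).
Hypothesis W_gh : graded_hilbert W.

(** Parseval over the weight decomposition; [r] may be any finite list of weights containing the
    support of [w]. *)
Lemma wnorm_rE (p : R) (w : W) (r : seq R) : uniq r ->
  (forall s, s \notin r -> mod_pr s w = 0) ->
  wnorm_r p w ^+ 2 = \sum_(s <- r) ((1 + s) `^ p * nrm W (mod_pr s w)) ^+ 2.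
Proof.
move=> ur r0; rewrite /wnorm_r (fsum_seq ur); last first.
  by move=> s /r0->; rewrite scaler0.
rewrite (wnorm_sum_sqr (gh_ip W_gh) ur).
  apply: eq_bigr => s _; rewrite (wnormZ (gh_ip W_gh)) /= expr0n /= addr0.
  by rewrite sqrtr_sqr ger0_norm ?powR_ge0.
move=> s t st; rewrite (ipZl (gh_ip W_gh)) (ipZr (gh_ip W_gh)).
by rewrite (gh_orth W_gh _ _ st) ?mulr0//; apply: component_pr; exact: gh_sum.
Qed.

Lemma wnorm_r_hom p t (w : W) : hom W t w -> wnorm_r p w = (1 + t) `^ p * nrm W w.
Proof.
move=> wt; apply/eqP; rewrite -(@eqrXn2 _ 2)// ?wnorm_ge0//; last first.
  by rewrite mulr_ge0 ?powR_ge0 ?wnorm_ge0.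
rewrite (@wnorm_rE _ _ [:: t])// ?big_seq1 ?wt// => s; rewrite inE => st.
exact: (pr_component_neq (gh_sum W_gh) wt).
Qed.

End GradedNorm.

Definition weight_shift (R : realType) (V : voaData R) (Wj Wk : umodData V)
    (delta : R -> R) (A : R -> Wj -> Wk) : Prop :=
  forall s t w, hom Wj t w -> hom Wk (t + delta s) (A s w).

(** One natural exponent serves for both the mode and the weight, so that such bounds are easily
    added and composed. The set [P] of modes is there because the conformal field is estimated only
    at the modes 0, 1 and 2. *)
Definition poly_bounded (R : realType) (V : voaData R) (Wj Wk : umodData V)
    (P : set R) (A : R -> Wj -> Wk) : Prop :=
  exists M : R, exists p : nat, 0 <= M /\
    forall s t w, P s -> hom Wj t w -> 0 <= t ->
      nrm Wk (A s w) <= M * ((1 + `|s|) * (1 + t)) ^+ p * nrm Wj w.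

Lemma powR_le_bound (R : realType) (x y : R) (n : nat) :
  1 <= x -> y <= n%:R -> x `^ y <= x ^+ n.
Proof.
by move=> x1 yn; rewrite -powR_mulrn ?(le_trans ler01)//; exact: ler_powR.
Qed.

Section EnergyBounds.
Variables (R : realType) (V : voaData R) (Wj Wk : umodData V).
Hypotheses (Wj_gh : graded_hilbert Wj) (Wk_gh : graded_hilbert Wk).

(** A constant shift sends distinct weights to distinct weights, so the images of the components of
    [w] stay orthogonal and Parseval applies on both sides. *)
Lemma shift_norm_le (A : Wj -> Wk) (delta K p : R) : linear A -> 0 <= K ->
  (forall t w, hom Wj t w -> hom Wk (t + delta) (A w)) ->
  (forall t w, hom Wj t w -> 0 <= t ->
    nrm Wk (A w) <= K * (1 + t) `^ p * nrm Wj w) ->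
  forall w, nrm Wk (A w) <= K * wnorm_r p w.
Proof.
move=> A_lin K0 A_hom A_le w.
have [r [ur r0 wE]] := pr_decomposition (gh_sum Wj_gh) w.
rewrite -(@ler_pXn2r _ 2)// ?nnegrE ?mulr_ge0 ?wnorm_ge0//.
rewrite exprMn (wnorm_rE Wj_gh _ ur r0) mulr_sumr [in leLHS]wE.
rewrite (linearP_sum A_lin) (wnorm_sum_sqr (gh_ip Wk_gh) ur); last first.
  move=> s t st; have hs u := A_hom _ _ (component_pr (gh_sum Wj_gh) u w).
  by apply: (gh_orth Wk_gh (hs s) (hs t)); rewrite (inj_eq (addIr _)).
apply: ler_sum => s _; rewrite -exprMn ler_pXn2r// ?nnegrE.
- have [->|ws0] := eqVneq (mod_pr s w) 0.
    rewrite (linearP0 A_lin) (wnorm0 (gh_ip Wk_gh)).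
    by rewrite mulr_ge0// mulr_ge0 ?powR_ge0 ?wnorm_ge0.
  have ws := component_pr (gh_sum Wj_gh) s w.
  by rewrite mulrA A_le//; exact: (gh_ge0 Wj_gh ws).
- exact: wnorm_ge0.
- by rewrite mulr_ge0// mulr_ge0 ?powR_ge0 ?wnorm_ge0.
Qed.

Lemma energy_bounds_poly (A : R -> Wj -> Wk) (r : R) :
  energy_bounds r A -> poly_bounded setT A.
Proof.
move=> [M [t [M0 t0 Ale]]].
(* A natural number above both exponents; raising an exponent is harmless because both bases are at
   least 1. *)
pose p := maxn (Num.bound t) (Num.bound `|r|).
exists M, p; split=> // s u w _ wu u0.
rewrite (le_trans (Ale s w))// (wnorm_r_hom Wj_gh _ wu) mulrA.
rewrite ler_wpM2r ?wnorm_ge0// -mulrA ler_wpM2l// exprMn.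
rewrite ler_pM ?powR_ge0//; apply: powR_le_bound; rewrite ?lerDl//.
  by rewrite (le_trans (ltW (archi_boundP t0)))// ler_nat leq_maxl.
rewrite (le_trans (ler_norm _))// (le_trans (ltW (archi_boundP _)))//.
by rewrite ler_nat leq_maxr.
Qed.

Lemma poly_energy_bounded (A : R -> Wj -> Wk) (delta : R -> R) :
  (forall s, linear (A s)) -> weight_shift delta A -> poly_bounded setT A ->
  energy_bounded A.
Proof.
move=> A_lin A_shift [M [p [M0 Ale]]]; exists p%:R => //; exists M, p%:R; split=> // s.
apply: (shift_norm_le (A_lin s) _ (A_shift s)).
  by rewrite mulr_ge0 ?powR_ge0.
move=> t w wt t0; rewrite !powR_mulrn ?addr_ge0// -[M * _ * _]mulrA -exprMn.
exact: Ale.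
Qed.

End EnergyBounds.

Section PolyBoundedSubspace.
Variables (R : realType) (V : voaData R) (Wj Wk : umodData V).
Hypotheses (Wk_gh : graded_hilbert Wk).

Lemma poly_bounded0 P : poly_bounded P (fun (_ : R) (_ : Wj) => 0 : Wk).
Proof.
exists 0, 0%N; split=> // s t w _ _ _.
by rewrite (wnorm0 (gh_ip Wk_gh)) !mul0r.
Qed.

Lemma poly_boundedZD P (a : R[i]) (A B : R -> Wj -> Wk) :
  poly_bounded P A -> poly_bounded P B ->
  poly_bounded P (fun s w => a *: A s w + B s w).
Proof.
move=> [M [p [M0 Ale]]] [N [q [N0 Ble]]].
have a0 : 0 <= Normc.normc a by case: a => x y; exact: sqrtr_ge0.
exists (Normc.normc a * M + N), (p + q)%N; split.
  by rewrite addr_ge0 ?mulr_ge0.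
move=> s t w Ps wt t0; rewrite (le_trans (wnormD (gh_ip Wk_gh) _ _))//.
rewrite (wnormZ (gh_ip Wk_gh)).
have := Ble s t w Ps wt t0; have := Ale s t w Ps wt t0.
(* Since this base is at least 1, the exponents p and q may both be raised to p + q. *)
have : 1 <= (1 + `|s|) * (1 + t) by rewrite mulr_ege1 ?lerDl.
move: (_ * (1 + t)) => X X1 AX BX; have X0 := le_trans ler01 X1.
rewrite !mulrDl lerD//.
  rewrite -!mulrA ler_wpM2l// mulrA (le_trans AX)//.
  rewrite ler_wpM2r ?wnorm_ge0// ler_wpM2l// exprD.
  by rewrite ler_peMr ?exprn_ege1 ?exprn_ge0.
rewrite (le_trans BX)// ler_wpM2r ?wnorm_ge0// ler_wpM2l// exprD.
by rewrite ler_peMl ?exprn_ege1 ?exprn_ge0.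
Qed.

End PolyBoundedSubspace.

(** * Riesz representation and the antiunitary map onto the contragredient module *)

Section Riesz.
Variables (R : realType) (V : voaData R) (W : umodData V).
Hypothesis W_gh : graded_hilbert W.
Local Notation ip := (@umod_ip _ _ W).
Let ipP := gh_ip W_gh.
Let prP := gh_sum W_gh.

(* Gram-Schmidt: x - p is orthogonal to the span of s. *)
Lemma riesz_span (s : seq W) (f : W -> R[i]) : linear (f : W -> R[i]^o) ->
  exists2 w, lspan [set` s] w & forall u, u \in s -> f u = ip u w.
Proof.
elim: s f => [|x s IHs] f f_lin.
  by exists 0 => //; case: (subspace_lspan [set` ([::] : seq W)]).
have [w0 w0s fw0] := IHs f f_lin.
have [p ps fp] := IHs (fun u => ip u x) (ip_linear ipP x).
have sub_span : lspan [set` s] `<=` lspan [set` x :: s].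
  move=> u us U sU xU; apply: us => // v /= vs; apply: xU => /=.
  by rewrite inE vs orbT.
have xs : lspan [set` x :: s] x by apply: sub_lspan => /=; rewrite inE eqxx.
have orth u : lspan [set` s] u -> ip u (x - p) = 0.
  move=> /(_ [set v | ip v (x - p) = 0]); apply.
    split=> [|a v v' /= v0 v'0]; first exact: (ip0l ipP).
    by rewrite (ipDl ipP) (ipZl ipP) v0 v'0 mulr0 addr0.
  by move=> v /= vs; rewrite (ipBr ipP) -fp// subrr.
(* Here <x|x - p> = |x - p|^2. If it vanishes, x = p already lies in the span of s and [w0] still
   works. *)
have [xp0|xp0] := eqVneq (ip x (x - p)) 0.
  have xE : x = p.
    apply/eqP; rewrite -subr_eq0; apply/eqP.
    by case: ipP => _ _ _; apply; rewrite (ipBl ipP) xp0 orth// subrr.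
  exists w0; first exact: sub_span.
  move=> u; rewrite inE => /orP[/eqP->|]; last exact: fw0.
  have : lspan [set` s] x by rewrite xE.
  move=> /(_ [set v | f v = ip v w0]); apply; last exact: fw0.
  split=> [|a v v' /= v0 v'0]; first by rewrite /= (linearP0 f_lin) (ip0l ipP).
  by rewrite f_lin (ipDl ipP) (ipZl ipP) v0 v'0.
(* A multiple of x - p corrects the value at x without changing those on s; the coefficient is
   conjugated because the inner product is antilinear on that side. *)
pose c := (f x - ip x w0) / ip x (x - p).
exists (w0 + c^*%C *: (x - p)).
  apply: subspaceD (subspace_lspan _) _ _; first exact: sub_span.
  apply: subspaceZ (subspace_lspan _) _.
  by apply: subspaceB (subspace_lspan _) _ _ => //; exact: sub_span.
move=> u; rewrite inE (ipDr ipP) (ipZr ipP) conjcK => /orP[/eqP->|us].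
  by rewrite divfK// addrC subrK.
by rewrite orth ?mulr0 ?addr0 ?fw0//; exact: sub_lspan.
Qed.

Lemma ip_pr t u w : hom W t u -> ip u (mod_pr t w) = ip u w.
Proof.
move=> ut; have [r [ur r0 wE]] := pr_decomposition prP w.
have orth s : s != t -> ip u (mod_pr s w) = 0.
  move=> st; rewrite (ip_conj ipP).
  by rewrite (gh_orth W_gh (component_pr prP s w) ut st) conjc0.
rewrite [in RHS]wE (ip_sumr ipP); have [tr|tr] := boolP (t \in r).
  by rewrite (bigD1_seq t)//= big1 ?addr0// => s; exact: orth.
rewrite r0// (ip0r ipP) big_seq big1// => s sr; apply: orth.
by apply: contraNneq tr => <-.
Qed.

Lemma ip_pr_adj s u w : ip (mod_pr s u) w = ip u (mod_pr s w).
Proof.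
rewrite -(ip_pr w (component_pr prP s u)) [RHS](ip_conj ipP).
by rewrite -(ip_pr u (component_pr prP s w)) -(ip_conj ipP).
Qed.

Lemma riesz_hom t (f : W -> R[i]) : linear (f : W -> R[i]^o) ->
  exists2 w, hom W t w & forall u, hom W t u -> f u = ip u w.
Proof.
move=> f_lin; have [s ts] := gh_fin W_gh t.
have [w _ fw] := riesz_span s f_lin.
(* The spanning vectors need not have weight t, so the representative has to be projected. *)
exists (mod_pr t w); first exact: component_pr.
move=> u ut; rewrite ip_pr//.
have := ts u ut; move=> /(_ [set v | f v = ip v w]); apply; last exact: fw.
split=> [|a v v' /= v0 v'0]; first by rewrite /= (linearP0 f_lin) (ip0l ipP).
by rewrite f_lin (ipDl ipP) (ipZl ipP) v0 v'0.
Qed.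

(** A functional in the graded dual sees finitely many weights, so its representatives on these
    weight spaces can be added up. *)
Lemma riesz_graded (f : W -> R[i]^o) : in_graded_dual f ->
  exists w, forall u, f u = ip u w.
Proof.
move=> [f_lin /finite_seqP[r rE]].
have /choice[g gP] : forall t, exists w, hom W t w /\
    forall u, hom W t u -> f u = ip u w.
  by move=> t; have [w wt fw] := riesz_hom t f_lin; exists w.
exists (\sum_(t <- undup r) g t) => u.
have [ru [_ _ ->]] := pr_decomposition prP u.
rewrite (linearP_sum f_lin) (ip_suml ipP); apply: eq_bigr => s _.
have us := component_pr prP s u; rewrite (ip_sumr ipP).
have orth t : t != s -> ip (mod_pr s u) (g t) = 0.
  by move=> ts; apply: (gh_orth W_gh us (gP t).1); rewrite eq_sym.
have [sr|sr] := boolP (s \in undup r).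
  rewrite (bigD1_seq s) ?undup_uniq//= big1 ?addr0//.
  by case: (gP s) => _; apply.
rewrite big_seq big1 => [|t tr]; last first.
  by apply: orth; apply: contraNneq sr => <-.
apply: contraNeq sr; rewrite mem_undup => fs.
by have : [set` r] s by rewrite -rE; exists u.
Qed.

(** The projections are self-adjoint, so <.|w> is supported on the weights of [w]; hence the default
    value in [conj_map] is never taken. *)
Lemma conj_map_dual w : in_graded_dual (fun u => ip u w : R[i]^o).
Proof.
split; first exact: (ip_linear ipP).
apply: (@sub_finite_set _ _ [set s | mod_pr s w != 0]); last by case: prP.
move=> s [u]; apply: contraNneq => w0.
by rewrite ip_pr_adj w0 (ip0r ipP).
Qed.

Lemma conj_mapE w u : conj_map w u = ip u w.
Proof.
rewrite /conj_map -[LHS]/(val (insubd _ _) u) val_insubd.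
by rewrite ifT//; exact/asboolT/conj_map_dual.
Qed.

Lemma graded_dual_eq (f g : graded_dual W) : (forall u, f u = g u) -> f = g.
Proof. by move=> fg; apply/val_inj/funext. Qed.

Lemma conj_map_inj : injective (@conj_map _ _ W).
Proof. by move=> u v uv; apply: (ip_eq ipP) => x; rewrite -!conj_mapE uv. Qed.

Lemma conj_map_surj (f : graded_dual W) : exists w, conj_map w = f.
Proof.
case: f => f fP; have [w fw] := riesz_graded (asboolW fP).
by exists w; apply: graded_dual_eq => u; rewrite conj_mapE.
Qed.

Lemma conj_mapK (w : W) : conj_inv (conj_map w) = w.
Proof.
apply: conj_map_inj; rewrite /conj_inv; case: xgetP => [u _ //|].
by move=> /(_ w) /= /(_ erefl).
Qed.

Lemma conj_map_linear (a : R[i]) u v :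
  conj_map (a *: u + v) = a^*%C *: conj_map u + conj_map v :> graded_dual W.
Proof.
apply: graded_dual_eq => x.
rewrite -[RHS]/(a^*%C * (conj_map u x) + conj_map v x).
by rewrite !conj_mapE (ipDr ipP) (ipZr ipP).
Qed.

Lemma conj_map0 : conj_map (0 : W) = 0 :> graded_dual W.
Proof.
by apply: graded_dual_eq => u; rewrite conj_mapE (ip0r ipP).
Qed.

Lemma conj_map_sum J (r : seq J) (c : J -> R) (F : J -> W) :
  conj_map (\sum_(i <- r) (c i)%:C%C *: F i) =
  \sum_(i <- r) (c i)%:C%C *: conj_map (F i) :> graded_dual W.
Proof.
elim: r => [|i r IHr]; first by rewrite !big_nil conj_map0.
by rewrite !big_cons conj_map_linear IHr conjc_real.
Qed.

Lemma transposeE (W' : umodData V) (A : W' -> W) (f : graded_dual W) :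
  in_graded_dual (f \o A : W' -> R[i]^o) -> forall u, transpose A f u = f (A u).
Proof.
move=> fA u; rewrite /transpose -[LHS]/(val (insubd _ _) u) val_insubd.
by rewrite ifT//; exact: asboolT fA.
Qed.

Lemma wnorm_conj_map w : @wnorm _ _ (ucontragredient W) (conj_map w) = nrm W w.
Proof. by rewrite /wnorm /= !conj_mapK. Qed.

Lemma pr_conj_map s w :
  @mod_pr _ _ (ucontragredient W) s (conj_map w) = conj_map (mod_pr s w).
Proof.
apply: graded_dual_eq => u; rewrite transposeE ?conj_mapE ?ip_pr_adj//.
rewrite (_ : _ \o _ = (fun u => ip u (mod_pr s w))); first exact: conj_map_dual.
by apply/funext => v; rewrite /= conj_mapE ip_pr_adj.
Qed.

Lemma wnorm_r_conj_map p w :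
  @wnorm_r _ _ (ucontragredient W) p (conj_map w) = wnorm_r p w.
Proof.
have [r [ur r0 _]] := pr_decomposition prP w.
rewrite /wnorm_r -wnorm_conj_map; congr wnorm.
rewrite [in RHS](fsum_seq ur) => [|s /r0->]; last by rewrite scaler0.
rewrite conj_map_sum (fsum_seq ur) => [|s /r0 sr]; last first.
  by rewrite pr_conj_map sr conj_map0 scaler0.
by apply: eq_bigr => s _; rewrite pr_conj_map.
Qed.

End Riesz.

Lemma powR_le_base (R : realType) (p x y : R) :
  0 <= p -> 0 <= x -> x <= y -> x `^ p <= y `^ p.
Proof.
by move=> p0 x0 xy; apply: ge0_ler_powR => //; rewrite nnegrE// (le_trans x0).
Qed.

(** * Adjoints and transposes of weight-shifting operators *)

Section Adjoint.
Variables (R : realType) (V : voaData R) (Wj Wk : umodData V).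
Hypotheses (Wj_gh : graded_hilbert Wj) (Wk_gh : graded_hilbert Wk).
Let ipPj := gh_ip Wj_gh.
Let ipPk := gh_ip Wk_gh.

Section OneOperator.
Variables (A : Wj -> Wk) (delta : R).
Hypothesis A_lin : linear A.
Hypothesis A_hom : forall t w, hom Wj t w -> hom Wk (t + delta) (A w).

Lemma adjoint_dual w : in_graded_dual (fun u => @umod_ip _ _ Wk (A u) w : R[i]^o).
Proof.
split; first by move=> a u v; rewrite A_lin (ip_linear ipPk).
have [r [_ r0 _]] := pr_decomposition (gh_sum Wk_gh) w.
(* On weight s the functional vanishes unless s + delta is a weight in the support of w. *)
apply: (@sub_finite_set _ _ [set` [seq s - delta | s <- r]]); last exact: finite_seq.
move=> s [u us]; apply/mapP; exists (s + delta); last by rewrite addrK.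
apply: contraNT us => /r0 ws.
have us : hom Wk (s + delta) (A (mod_pr s u)).
  by apply: A_hom; apply: component_pr; exact: gh_sum.
by rewrite -(ip_pr Wk_gh w us) ws (ip0r ipPk).
Qed.

(** Riesz representation supplies a witness, so [xget] does not fall back on 0. *)
Lemma adjointP u w : @umod_ip _ _ Wk (A u) w = @umod_ip _ _ Wj u (adjoint A w).
Proof.
rewrite /adjoint; case: xgetP => [x _ -> //|].
by have [x xP] := riesz_graded Wj_gh (adjoint_dual w) => /(_ x) [].
Qed.

Lemma adjoint_linear : linear (adjoint A).
Proof.
move=> a u v; apply: (ip_eq ipPj) => x.
by rewrite -adjointP (ipDr ipPk) (ipZr ipPk) !adjointP -(ipZr ipPj) -(ipDr ipPj).
Qed.

Lemma adjoint_hom t w : hom Wk t w -> hom Wj (t - delta) (adjoint A w).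
Proof.
move=> wt; apply: (ip_eq ipPj) => u.
rewrite -(ip_pr_adj Wj_gh) -!adjointP.
have [r [_ _ ->]] := pr_decomposition (gh_sum Wj_gh) u.
rewrite (pr_sum (gh_sum Wj_gh)) !(linearP_sum A_lin) !(ip_suml ipPk).
apply: eq_bigr => s _; rewrite (pr_pr (gh_sum Wj_gh)).
have us := component_pr (gh_sum Wj_gh) s u.
have [<-//|st] := eqVneq; rewrite (linearP0 A_lin) (ip0l ipPk).
rewrite (gh_orth Wk_gh (A_hom us) wt)//; apply: contraNneq st => <-.
by rewrite addrK.
Qed.

Lemma transpose_adjoint w : transpose A (conj_map w) = conj_map (adjoint A w).
Proof.
apply: graded_dual_eq => u; rewrite transposeE.
  by rewrite !conj_mapE// adjointP.
rewrite (_ : _ \o _ = (fun u => @umod_ip _ _ Wk (A u) w)); first exact: adjoint_dual.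
by apply/funext => v; rewrite /= conj_mapE.
Qed.

(* |A^* w|^2 = <A A^* w | w>, and A^* w has weight t - delta. *)
Lemma wnorm_adjoint_le (K p : R) : 0 <= K -> 0 <= p ->
  (forall w, nrm Wk (A w) <= K * wnorm_r p w) ->
  forall w, nrm Wj (adjoint A w) <= K * (1 + `|delta|) `^ p * wnorm_r p w.
Proof.
move=> K0 p0 A_le.
apply: (shift_norm_le Wk_gh Wj_gh (delta := - delta) adjoint_linear).
- by rewrite mulr_ge0// powR_ge0.
- exact: adjoint_hom.
move=> t w wt t0; have ht := adjoint_hom wt.
have [->|x0] := eqVneq (adjoint A w) 0.
  by rewrite (wnorm0 ipPj) !mulr_ge0 ?powR_ge0 ?wnorm_ge0.
have td := gh_ge0 Wj_gh ht x0.
rewrite -(ler_pM2r (wnorm_gt0 ipPj x0)) -expr2 (wnorm_sqr ipPj) -adjointP.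
rewrite (le_trans (Re_ip_le ipPk _ _))// mulrAC ler_wpM2r ?wnorm_ge0//.
rewrite (le_trans (A_le _))// (wnorm_r_hom Wj_gh _ ht) mulrA.
rewrite ler_wpM2r ?wnorm_ge0// -mulrA ler_wpM2l// -powRM ?addr_ge0//.
have dle : - delta <= `|delta| by rewrite -normrN ler_norm.
have dt : 0 <= `|delta| * t by rewrite mulr_ge0.
(* The bases compare as 1 + t - delta <= (1 + |delta|)(1 + t). *)
apply: powR_le_base => //; first by rewrite addr_ge0.
by move: (`|delta|) dle dt => d; lra.
Qed.

End OneOperator.

Variables (A : R -> Wj -> Wk) (delta : R -> R).
Hypothesis A_lin : forall s, linear (A s).
Hypothesis A_shift : weight_shift delta A.

(** The factor (1 + |delta s|)^r lost by taking adjoints is at most (1 + c)^r (1 + |s|)^r. It is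
    absorbed by the constant and the exponent of the mode, so the order r survives. *)
Lemma energy_bounds_adjoint (c r : R) : 0 <= c -> 0 <= r ->
  (forall s, `|delta s| <= c + `|s|) ->
  energy_bounds r A -> energy_bounds r (fun s => adjoint (A s)).
Proof.
move=> c0 r0 dle [M [t [M0 t0 Ale]]].
exists (M * (1 + c) `^ r), (t + r); split; rewrite ?mulr_ge0 ?addr_ge0 ?powR_ge0//.
move=> s w.
have K0 : 0 <= M * (1 + `|s|) `^ t by rewrite mulr_ge0// powR_ge0.
rewrite (le_trans (wnorm_adjoint_le (A_lin s) (A_shift s) K0 r0 (Ale s) w))//.
rewrite ler_wpM2r ?wnorm_ge0// powRD; last first.
  by apply/implyP => _; rewrite gt_eqF// ltr_pwDl.
rewrite [leRHS]mulrACA -[leLHS]mulrA [leRHS](_ : _ =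
  M * ((1 + `|s|) `^ t * ((1 + c) `^ r * (1 + `|s|) `^ r))); last by ring.
rewrite ler_wpM2l// ler_wpM2l ?powR_ge0// -powRM ?addr_ge0//.
have := dle s; have := normr_ge0 s; have := normr_ge0 (delta s) => d0 s0 ds.
by apply: powR_le_base; rewrite ?addr_ge0//; nra.
Qed.

(** The transpose is the adjoint conjugated by the maps [conj_map], which preserve the norm and the
    r-norm. *)
Lemma energy_bounds_transpose (r : R) :
  energy_bounds r (fun s => adjoint (A s)) ->
  @energy_bounds _ _ (ucontragredient Wk) (ucontragredient Wj) r
    (fun s => transpose (A s)).
Proof.
move=> [M [t [M0 t0 Ale]]]; exists M, t; split=> // s f.
have [w <-] := conj_map_surj Wk_gh f.
rewrite (transpose_adjoint (A_lin s) (A_shift s)).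
by rewrite (wnorm_conj_map Wj_gh) (wnorm_r_conj_map Wk_gh).
Qed.

Lemma energy_bounds_conj (r : R) : energy_bounds r A ->
  @energy_bounds _ _ (ucontragredient Wj) (ucontragredient Wk) r
    (fun s g => conj_map (A s (conj_inv g))).
Proof.
move=> [M [t [M0 t0 Ale]]]; exists M, t; split=> // s f.
have [w <-] := conj_map_surj Wj_gh f.
by rewrite conj_mapK// (wnorm_conj_map Wk_gh) (wnorm_r_conj_map Wj_gh).
Qed.

End Adjoint.

(** * Binomial coefficients and specializations of the Jacobi identity *)

Section Binomial.
Variable R : realType.

Lemma binz_nat (n l : nat) : binz R n%:Z l = ('C(n, l))%:R.
Proof.
have prodE : \prod_(i < l) (n%:Z - i%:Z)%:~R = (n ^_ l)%:R :> R[i].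
  elim: l => [|l IHl]; first by rewrite big_ord0.
  rewrite big_ord_recr /= IHl ffactnSr natrM; have [ln|nl] := leqP l n.
    by rewrite natrB// rmorphB.
  by rewrite ffact_small// !mul0r.
by rewrite /binz prodE -bin_ffact natrM mulfK// pnatr_eq0 -lt0n fact_gt0.
Qed.

Lemma binz_n0 n : binz R n 0 = 1.
Proof. by rewrite /binz big_ord0 fact0 divr1. Qed.

Lemma binz_0n l : binz R 0 l = (l == 0%N)%:R.
Proof. by rewrite -[0]/(0%N%:Z) binz_nat bin0n. Qed.

End Binomial.

Section JacobiIdentity.
Variables (R : realType) (I : pzRingType) (V U Wj Wk : lmodType R[i]).
Variables (yU : V -> int -> U -> U) (yj : V -> int -> Wj -> Wj).
Variables (yk : V -> int -> Wk -> Wk) (y : U -> I -> Wj -> Wk).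
Hypothesis jac : jacobi yU yj yk y.

(** The Jacobi identity with n = 0: on the right only the terms l = 0 survive. *)
Lemma jacobi_commutator u (m : nat) s w wj :
  \sum_(l < m.+1) ('C(m, l))%:R *: y (yU u l%:Z w) (m%:R + s - l%:R) wj =
  yk u m%:Z (y w s wj) - y w s (yj u m%:Z wj).
Proof.
have := jac u m%:Z 0 s w wj; rewrite (@fsum_nat _ m.+1); last first.
  by move=> l ml; rewrite binz_nat bin_small// scale0r.
rewrite (@fsum_only _ _ 0%N); last first.
  by move=> l /negPf l0; rewrite binz_0n l0 mulr0 scale0r.
rewrite (@fsum_only _ _ 0%N); last first.
  by move=> l /negPf l0; rewrite binz_0n l0 mulr0 scale0r.
rewrite binz_0n /= !mulr1 !scale1r !addr0 !subr0 add0r => <-.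
by apply: eq_bigr => l _; rewrite binz_nat add0r.
Qed.

(** The Jacobi identity with m = 0: on the left only the term l = 0 survives. *)
Lemma jacobi_associator u n s w wj :
  y (yU u n w) s wj =
  \sum_(l \in [set: nat]) ((-1) ^+ l * binz R n l) *:
     yk u (n - l%:Z) (y w (s + l%:R) wj)
  - \sum_(l \in [set: nat]) ((-1) ^ (l%:Z + n) * binz R n l) *:
     y w (n%:~R + s - l%:R) (yj u l%:Z wj).
Proof.
have := jac u 0 n s w wj; rewrite (@fsum_only _ _ 0%N); last first.
  by move=> l /negPf l0; rewrite binz_0n l0 scale0r.
rewrite binz_0n /= scale1r !addr0 add0r subr0 => ->.
by congr (_ - _); apply: eq_fsbigr => l _; rewrite add0r.
Qed.

End JacobiIdentity.

(* The properties that an intertwining operator and a module vertex operator, its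
   modes being indexed by R, have in common. *)
Record charged_field (R : realType) (V : voaData R) (U : lmodType R[i])
    (yU : V -> int -> U -> U) (Wj Wk : modData V) (y : U -> R -> Wj -> Wk) : Prop := {
  cf_bilinear : bilinear_modes y;
  cf_derivative : forall w s wj,
    y (yU (conf V) 0 w) s wj = - ((s%:C)%C *: y w (s - 1) wj);
  cf_jacobi : jacobi yU (@mod_Y _ _ Wj) (@mod_Y _ _ Wk) y }.

(** * Module vertex operators with real modes, and weight shifts of charged fields *)

Section RealModes.
Variables (R : realType) (V : voaData R) (W : modData V).

Lemma real_modes_int v k (w : W) : real_modes v k%:~R w = mod_Y v k w.
Proof. by rewrite /real_modes intr_int intrKfloor. Qed.

Lemma real_modes_nint v s (w : W) : s \isn't a Num.int -> real_modes v s w = 0.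
Proof. by rewrite /real_modes => /negPf->. Qed.

Hypothesis W_weak : is_weak_module (@mod_Y _ _ W).

Lemma real_modes_linear v s : linear (real_modes (W := W) v s).
Proof.
move=> a u w; rewrite /real_modes; case: ifP => _; last by rewrite scaler0 addr0.
by case: (mod_bilinear W_weak) => H _; rewrite H.
Qed.

Lemma real_modes_charged :
  charged_field (@voa_Y _ V) (real_modes (W := W)).
Proof.
split.
- split=> [w s|s wj a u v]; first exact: real_modes_linear.
  rewrite /real_modes; case: ifP => _; last by rewrite scaler0 addr0.
  by case: (mod_bilinear W_weak) => _ H; exact: H.
- move=> v s w; have [/intrP[k ->]|sN] := boolP (s \is a Num.int).
    rewrite -[_ - 1](rmorphB _ k 1) !real_modes_int (mod_derivative W_weak).
    by rewrite rmorph_int.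
  rewrite !real_modes_nint ?scaler0 ?oppr0//.
  by rewrite rpredBr ?rpred1.
move=> u m n s v w; have [/intrP[k ->]|sN] := boolP (s \is a Num.int).
  have eD l : k%:~R + l%:R = (k + l%:R)%:~R :> R by rewrite rmorphD /= natz.
  have eB a l : a%:~R + k%:~R - l%:R = (a%:~R + k - l%:R)%:~R :> R.
    by rewrite rmorphB rmorphD /= natz intz.
  transitivity (\sum_(l \in [set: nat])
      binz R m l *: mod_Y (voa_Y u (n + l%:Z) v) (m%:~R + k - l%:R) w).
    by apply: eq_fsbigr => l _; rewrite eB real_modes_int.
  rewrite (mod_jacobi W_weak).
  by congr (_ - _); apply: eq_fsbigr => l _; rewrite ?eD ?eB real_modes_int.
(* At a non-integral s every index in the three sums is non-integral, so all terms vanish. *)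
rewrite !fsbig1 ?subr0// => l _; rewrite real_modes_nint ?scaler0//.
- by rewrite rpredBr ?rpred_nat// rpredDl ?rpred_int.
- by case: (mod_bilinear W_weak) => H _; rewrite (linearP0 (H _ _)) scaler0.
- by rewrite rpredDr ?rpred_nat.
- by rewrite rpredBr ?rpred_nat// rpredDl ?rpred_int.
Qed.

End RealModes.

Section WeightShift.
Variables (R : realType) (V : voaData R) (U : lmodType R[i]).
Variables (yU : V -> int -> U -> U) (Wj Wk : modData V) (y : U -> R -> Wj -> Wk).
Hypotheses (Wj_mod : is_module Wj) (Wk_mod : is_module Wk).
Hypothesis yP : charged_field yU y.

Lemma charged_field_linear w s : linear (y w s).
Proof. by case: (cf_bilinear yP). Qed.

Lemma charged_field_linear_charge s wj : linear (fun w => y w s wj).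
Proof. by case: (cf_bilinear yP). Qed.

(* Commutator with L_0 = Y(nu, 1). *)
Lemma charged_field_shift (d : R) w : yU (conf V) 1 w = (d%:C)%C *: w ->
  forall s t wj, hom Wj t wj -> hom Wk (t + (d - s - 1)) (y w s wj).
Proof.
move=> dw s t wj wjt.
have prk : direct_sum_decomposition (@mod_pr _ _ Wk) by case: (mod_grading Wk_mod).
have L0_lin : linear (mod_Y (conf V) 1 : Wk -> Wk).
  by case: (mod_bilinear (mod_weak Wk_mod)).
apply: (eigen_component prk L0_lin (@complexI R)); first exact: mod_L0 Wk_mod.
have := jacobi_commutator (cf_jacobi yP) (conf V) 1 s w wj.
(* In [L_0, y(w, s)] the derivative property contributes -(s + 1) and the weight of w contributes d,
   whence the eigenvalue t + d - s - 1. *)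
rewrite big_ord_recl big_ord1 /= bin0 bin1 !scale1r (cf_derivative yP) dw.
rewrite (linearPZ (charged_field_linear_charge _ _)) /= subr0.
rewrite (_ : mod_Y (conf V) 1 wj = (t%:C)%C *: wj); last exact: (mod_L0 Wj_mod wjt).
rewrite (linearPZ (charged_field_linear _ _)) /= [1 + s]addrC addrK.
move/esym/eqP; rewrite subr_eq => /eqP->.
rewrite -scaleNr -!scalerDl; congr (_ *: _).
by rewrite -rmorphN -!rmorphD; congr (_%:C)%C; ring.
Qed.

End WeightShift.

(** * The Virasoro operators L_-1, L_0 and L_1 on a unitary module *)

Section ConformalVector.
Variables (R : realType) (V : voaData R) (V_voa : is_voa V).

(** L_1 L_-2 Omega = [L_1, L_-2] Omega = 3 L_-1 Omega = 0, since L_1 and L_-1 kill the vacuum and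
    the central term is absent. *)
Lemma vL1_conf : vL 1 (conf V) = 0.
Proof.
have [c vir] := voa_virasoro V_voa.
have [crea annih] := voa_creation V_voa (conf V).
have e1 : vL (-2) (vac V) = conf V := crea.
have e2 : vL 1 (vac V) = 0 := annih 2 isT.
have e3 : vL (1 - 2) (vac V) = 0 := annih 0 isT.
have := vir 1 (-2) (vac V); rewrite e1 e2 e3.
have lin : linear (vL (-2) : V -> V) by case: (voa_bilinear V_voa) => H _; exact: H.
by rewrite (linearP0 lin) scaler0 subr0 addr0.
Qed.

Lemma vL0_conf : vL 0 (conf V) = 2%:R *: conf V.
Proof. by rewrite (voa_L0 V_voa (voa_conf_weight V_voa)). Qed.

End ConformalVector.

Section UnitaryModule.
Variables (R : realType) (V : voaData R) (V_voa : is_voa V).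
Variables (theta : V -> V) (theta_nu : theta (conf V) = conf V).
Variables (W : umodData V) (W_unitary : unitary_module theta W).
Let W_mod := umod_module W_unitary.
Let W_weak := mod_weak W_mod.
Let ipP := umod_inner W_unitary.
Local Notation ip := (@umod_ip _ _ W).
Local Notation Y := (@mod_Y _ _ W (conf V)).

(** As [Y n] is L_(n-1), this says that L_n and L_-n are adjoint. The conformal vector is fixed by
    [theta] and quasi-primary of weight 2, so its opposite modes reduce to a single term. *)
Lemma conf_adjoint n u w : ip (Y n u) w = ip u (Y (2 - n) w).
Proof.
rewrite (umod_unitary W_unitary) theta_nu; congr (umod_ip _ _).
have prV : direct_sum_decomposition (@voa_pr _ V) by case: (voa_grading V_voa).
have nu2 := voa_conf_weight V_voa.
have Y0 m w' : mod_Y 0 m w' = 0 :> W.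
  by case: (mod_bilinear W_weak) => _ H; exact: (linearP0 (H _ _)).
have vL1_0 : vL 1 0 = 0 :> V.
  by case: (voa_bilinear V_voa) => H _; exact: (linearP0 (H _ _)).
have iter0 l : iter l (vL 1) 0 = 0 :> V by elim: l => //= l ->.
rewrite /opposite_modes (@fsum_only _ _ 2) => [|d d2]; last first.
  rewrite fsbig1// => l _.
  by rewrite (pr_component_neq prV nu2 d2) iter0 Y0 scaler0.
rewrite (@fsum_only _ _ 0%N) => [|l l0]; last first.
  by case: l l0 => // l _; rewrite nu2 iterSr vL1_conf// iter0 Y0 scaler0.
rewrite /= nu2 fact0 divr1 (_ : sign_phase R 2 = 1) ?scale1r; last first.
  by rewrite /sign_phase -[2]/(2%N%:Z) -exprnP sqrrN expr1n.
by rewrite (_ : 2 * 2 - 0 - n - 2 = 2 - n :> int)//; ring.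
Qed.

Lemma conf_L0 t w : hom W t w -> Y 1 w = (t%:C)%C *: w.
Proof. exact: (mod_L0 W_mod). Qed.

Lemma conf_shift n t w : hom W t w -> hom W (t + (1 - n%:~R)) (Y n w).
Proof.
move=> wt; rewrite -real_modes_int.
have := charged_field_shift W_mod W_mod (real_modes_charged W_weak).
move=> /(_ 2 (conf V) _ n%:~R t w wt); rewrite [2 - _ - 1](_ : _ = 1 - n%:~R); last by ring.
by apply; rewrite -[LHS]/(vL 0 (conf V)) vL0_conf// rmorph_nat.
Qed.

(** Module axioms give the relation [L_1, L_-1] = 2 L_0 through the commutator formula: the terms l
    = 0, 1, 2 contribute -2, 4 and 0 times L_0. *)
Lemma commutator_L1_Lm1 w : Y 2 (Y 0 w) - Y 0 (Y 2 w) = 2%:R *: Y 1 w.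
Proof.
have := jacobi_commutator (mod_jacobi W_weak) (conf V) 2 0 (conf V) w => /= <-.
rewrite !big_ord_recl big_ord0 /= !bin0 bin1 binn !scale1r addr0.
rewrite [voa_Y _ 0 _](_ : _ = vL (-1) (conf V))// (mod_derivative W_weak).
rewrite [voa_Y _ 1 _](_ : _ = vL 0 (conf V))// vL0_conf//.
rewrite [voa_Y _ _ _](_ : _ = vL 1 (conf V))// vL1_conf//.
case: (mod_bilinear W_weak) => _ H.
rewrite (linearPZ (H _ _)) (linearP0 (H _ _)) addr0.
rewrite !addr0 scalerA -scaleNr -scalerDl; congr (_ *: _).
by ring.
Qed.

(** |L_-1 w|^2 = <w|L_1 L_-1 w>, and L_1 L_-1 = L_-1 L_1 + 2 L_0. *)
Lemma wnorm_Lm1_sqr t w : hom W t w ->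
  nrm W (Y 0 w) ^+ 2 = nrm W (Y 2 w) ^+ 2 + 2 * t * nrm W w ^+ 2.
Proof.
move=> wt; rewrite (wnorm_sqr ipP) conf_adjoint subr0.
rewrite -[Y 2 (Y 0 w)](subrK (Y 0 (Y 2 w))) commutator_L1_Lm1.
rewrite (ipDr ipP) (conf_L0 wt) scalerA (ipZr ipP).
rewrite (_ : ip w (Y 0 (Y 2 w)) = ip (Y 2 w) (Y 2 w)); last first.
  by rewrite conf_adjoint subrr.
rewrite !(ip_wnorm ipP) -(rmorph_nat (real_complex R)) -rmorphM conjc_real.
by rewrite -rmorphM -rmorphD /=; ring.
Qed.

(* L_1 = Y(nu, 2) lowers weights, which are bounded below. *)
Lemma weight_ind (Q : R -> W -> Prop) :
  (forall t w, hom W t w -> (Y 2 w != 0 -> Q (t - 1) (Y 2 w)) -> Q t w) ->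
  forall t w, hom W t w -> Q t w.
Proof.
move=> step; have [_ _ [N N0]] := mod_grading W_mod.
suff H n t w : t < N + n%:R -> hom W t w -> Q t w.
  move=> t w; apply: (H (Num.bound `|t - N|)).
  by rewrite -ltrBlDl (le_lt_trans (ler_norm _))// archi_boundP.
elim: n t w => [|n IHn] t w tN wt; apply: step => // L1w0.
  have : component (@mod_pr _ _ W) (t - 1) (Y 2 w).
    by have := conf_shift 2 wt; rewrite (_ : 1 - 2%:~R = - 1 :> R)//; ring.
  by rewrite N0 => [/eqP|]; [rewrite (negPf L1w0)|lra].
apply: IHn; first by move: tN; rewrite -natr1; lra.
by have := conf_shift 2 wt; rewrite (_ : 1 - 2%:~R = - 1 :> R)//; ring.
Qed.

(** If L_1 w is nonzero, its weight t - 1 is nonnegative by induction; otherwise 2 t |w|^2 = |L_-1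
    w|^2 >= 0. *)
Lemma conf_weight_ge0 t w : hom W t w -> w != 0 -> 0 <= t.
Proof.
move: t w; apply: weight_ind => t w wt IH w0.
have [L1w0|L1w0] := eqVneq (Y 2 w) 0; last by have := IH L1w0 L1w0; lra.
have := wnorm_Lm1_sqr wt; rewrite L1w0 (wnorm0 ipP) expr0n add0r /= => E.
have := sqr_ge0 (nrm W (Y 0 w)); rewrite E -mulrA pmulr_rge0//.
by rewrite pmulr_lge0// exprn_gt0// (wnorm_gt0 ipP).
Qed.

(** Put x = |L_1 w|. Then x^2 = <L_-1 L_1 w|w> <= |L_-1 L_1 w| |w|, and by induction |L_-1 L_1 w|^2
    <= ((t - 1)^2 + 2 (t - 1)) x^2 <= t^2 x^2. *)
Lemma wnorm_L1_le t w : hom W t w -> 0 <= t -> nrm W (Y 2 w) <= t * nrm W w.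
Proof.
move: t w; apply: weight_ind => t w wt IH t0.
have [->|L1w0] := eqVneq (Y 2 w) 0.
  by rewrite (wnorm0 ipP) mulr_ge0// wnorm_ge0.
have L1wt : hom W (t - 1) (Y 2 w).
  by have := conf_shift 2 wt; rewrite (_ : 1 - 2%:~R = - 1 :> R)//; ring.
have t1 := conf_weight_ge0 L1wt L1w0; have {IH} := IH L1w0 t1.
have := wnorm_Lm1_sqr L1wt.
have : nrm W (Y 2 w) ^+ 2 <= nrm W (Y 0 (Y 2 w)) * nrm W w.
  rewrite (wnorm_sqr ipP) conf_adjoint subrr (ip_conj ipP).
  rewrite (_ : complex.Re (ip _ _)^*%C = complex.Re (ip (Y 0 (Y 2 w)) w)).
    exact: Re_ip_le.
  by case: (ip _ _).
have x0 := wnorm_gt0 ipP L1w0.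
have := wnorm_ge0 (Y 0 (Y 2 w)); have := wnorm_ge0 (Y 2 (Y 2 w)).
have := wnorm_ge0 w.
move: x0; move: (nrm W (Y 2 w)) (nrm W (Y 0 (Y 2 w))) (nrm W (Y 2 (Y 2 w))) (nrm W w).
move=> x a b z x0 z0 b0 a0 xa aE bx.
have b2 : b ^+ 2 <= ((t - 1) * x) ^+ 2.
  by rewrite ler_pXn2r// nnegrE// mulr_ge0// ltW.
have ax : a <= t * x.
  rewrite -(@ler_pXn2r _ 2)// ?nnegrE ?mulr_ge0 ?(ltW x0)// aE.
  by rewrite exprMn in b2; rewrite exprMn; nra.
rewrite -(ler_pM2l x0) -expr2 (le_trans xa)//.
by rewrite (le_trans (ler_wpM2r z0 ax))// mulrCA mulrA.
Qed.

Lemma wnorm_Lm1_le t w : hom W t w -> 0 <= t -> nrm W (Y 0 w) <= (1 + t) * nrm W w.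
Proof.
move=> wt t0; have := wnorm_Lm1_sqr wt; have := wnorm_L1_le wt t0.
have := wnorm_ge0 w; have := wnorm_ge0 (Y 2 w); have := wnorm_ge0 (Y 0 w).
move: (nrm W (Y 2 w)) (nrm W (Y 0 w)) (nrm W w) => b a z a0 b0 z0 bz aE.
have b2 : b ^+ 2 <= (t * z) ^+ 2 by rewrite ler_pXn2r// nnegrE mulr_ge0.
rewrite -(@ler_pXn2r _ 2)// ?nnegrE ?mulr_ge0 ?addr_ge0// aE.
have : 0 <= z ^+ 2 by rewrite sqr_ge0.
by rewrite exprMn in b2; rewrite exprMn; nra.
Qed.

(** Orthogonality of the weight spaces holds because L_0 is self-adjoint with distinct real
    eigenvalues on them. *)
Lemma unitary_graded_hilbert : graded_hilbert W.
Proof.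
case: (mod_grading W_mod) => prW finW _; split=> // [s t u v us vt st|].
  have := conf_adjoint 1 u v; rewrite (_ : 2 - 1 = 1 :> int)// (conf_L0 us) (conf_L0 vt).
  rewrite (ipZl ipP) (ipZr ipP) conjc_real => /eqP.
  rewrite -subr_eq0 -mulrBl mulf_eq0 subr_eq0 => /orP[/eqP/complexI st'|/eqP//].
  by rewrite st' eqxx in st.
exact: conf_weight_ge0.
Qed.

Lemma conf_poly_bounded :
  poly_bounded [set 0; 1; 2] (real_modes (W := W) (conf V)).
Proof.
exists 1, 1%N; split=> // s t w s012 wt t0; rewrite expr1 mul1r.
apply: (@le_trans _ _ ((1 + t) * nrm W w)); last first.
  by rewrite ler_wpM2r ?wnorm_ge0// ler_peMl ?addr_ge0// lerDl.
have w0 := wnorm_ge0 w.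
case: s012 => [[]|] ->.
- by rewrite (real_modes_int _ 0) wnorm_Lm1_le.
- rewrite (real_modes_int _ 1) (conf_L0 wt) (wnormZ ipP) /= expr0n addr0 sqrtr_sqr.
  by rewrite ger0_norm// ler_wpM2r// lerDr.
by rewrite (real_modes_int _ 2) (le_trans (wnorm_L1_le wt t0))// ler_wpM2r// lerDr.
Qed.

End UnitaryModule.

(** * Polynomial bounds through the associator formula *)

Section Associator.
Variable R : realType.

(** Bernoulli's inequality (1 + 1/x)^k >= 1 + k/x with denominators cleared. *)
Lemma mulrX_bernoulli (x : R) k : 1 <= x -> x ^+ k * (x + k%:R) <= (x + 1) ^+ k * x.
Proof.
move=> x1; elim: k => [|k IHk]; first by rewrite !expr0 !mul1r addr0.
rewrite !exprS -![in leRHS]mulrA.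
apply: (@le_trans _ _ ((x + 1) * (x ^+ k * (x + k%:R)))); last first.
  by rewrite ler_wpM2l//; lra.
rewrite -mulrA [leRHS]mulrCA [leLHS]mulrCA ler_wpM2l ?exprn_ge0//; first by lra.
by rewrite -natr1; have := ler0n R k; nra.
Qed.

(** Consecutive coefficients have ratio |n - l|/(l + 1) <= 1 + |n|/(l + 1), and the bound grows at
    least as fast by Bernoulli's inequality at x = l + 1. *)
Lemma normc_binz_le (n : int) (l : nat) :
  Normc.normc (binz R n l) <= (1 + l%:R) ^+ `|n|%N.
Proof.
elim: l => [|l IHl].
  by rewrite binz_n0 Normc.normc1 addr0 expr1n.
have -> : binz R n l.+1 = binz R n l * ((n - l%:Z)%:~R / l.+1%:R).
  rewrite /binz big_ord_recr /= factS natrM invfM; ring.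
have normR (x : R) : Normc.normc (x%:C)%C = `|x|.
  by rewrite /= expr0n addr0 sqrtr_sqr.
rewrite Normc.normcM.
have -> : (n - l%:Z)%:~R / l.+1%:R = (((n - l%:Z)%:~R / l.+1%:R : R)%:C)%C :> R[i].
  by rewrite rmorphM fmorphV rmorph_int rmorph_nat.
rewrite normR normrM normfV (ger0_norm (ler0n _ _)).
apply: (@le_trans _ _ ((1 + l%:R) ^+ `|n|%N * ((1 + l%:R + `|n|%N%:R) / (1 + l%:R)))).
  rewrite ler_pM//; first by case: (binz R n l) => a b; exact: sqrtr_ge0.
  rewrite [_.+1%:R](_ : _ = 1 + l%:R) ?natr1 -?nat1r// ler_pM2r ?invr_gt0 ?ltr_pwDl//.
  rewrite rmorphB /= (le_trans (ler_normB _ _))//.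
  rewrite -intr_norm natr_absz (ger0_norm (ler0n _ _)) addrC lerD2r//.
  by rewrite lerDr.
rewrite mulrA ler_pdivrMr ?ltr_pwDl// -nat1r.
by rewrite (le_trans (mulrX_bernoulli _ _)) ?lerDl// [1 + (1 + _)]addrC.
Qed.

Variables (V : voaData R) (Wa Wb Wc : umodData V).
Hypotheses (Wb_gh : graded_hilbert Wb) (Wc_gh : graded_hilbert Wc).

(* A term is nonzero only if a - l >= 0, hence l <= D X; so there are at most D X + 1
   nonzero terms, and every index and weight occurring in them is at most 2 D X. *)
Lemma wnorm_fsum_comp_le (A1 : R -> Wa -> Wb) (A2 : R -> Wb -> Wc) (P1 P2 : set R)
    (M1 M2 D X : R) (p1 p2 k : nat) (c : nat -> R[i]) (i1 i2 : nat -> R) (a t : R)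
    (v : Wa) :
  (forall s, linear (A2 s)) ->
  0 <= M1 -> 0 <= M2 -> 1 <= D -> 1 <= X ->
  (forall s t w, P1 s -> hom Wa t w -> 0 <= t ->
    nrm Wb (A1 s w) <= M1 * ((1 + `|s|) * (1 + t)) ^+ p1 * nrm Wa w) ->
  (forall s t w, P2 s -> hom Wb t w -> 0 <= t ->
    nrm Wc (A2 s w) <= M2 * ((1 + `|s|) * (1 + t)) ^+ p2 * nrm Wb w) ->
  (forall l, Normc.normc (c l) <= (1 + l%:R) ^+ k) ->
  (forall l, `|i1 l| <= D * X + l%:R) -> (forall l, `|i2 l| <= D * X + l%:R) ->
  a <= D * X -> t <= D * X -> hom Wa t v -> 0 <= t ->
  (forall l, hom Wb (a - l%:R) (A1 (i1 l) v)) ->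
  (forall l, c l != 0 -> P1 (i1 l) /\ P2 (i2 l)) ->
  nrm Wc (\sum_(l \in [set: nat]) c l *: A2 (i2 l) (A1 (i1 l) v)) <=
  M1 * M2 * ((2 * D + 1) * X) ^+ (1 + k + p1.*2 + p2.*2) * nrm Wa v.
Proof.
move=> A2_lin M10 M20 D1 X1 A1_le A2_le c_le i1_le i2_le a_le t_le vt t0 A1_hom cP.
have A10 l : D * X < l%:R -> A1 (i1 l) v = 0.
  move=> lD; apply/eqP; apply: contraTT isT => A1v.
  by have := gh_ge0 Wb_gh (A1_hom l) A1v; lra.
have DX0 : 0 <= D * X by rewrite mulr_ge0// (le_trans ler01).
(* For every nonzero term, [Z] dominates 1 + l, 1 + |i1 l|, 1 + |i2 l|, 1 + t and 1 + a - l, as well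
   as the number of terms; this explains the exponent 1 + k + 2 p1 + 2 p2. *)
set Z := (2 * D + 1) * X.
have ZE : Z = D * X + D * X + X by rewrite /Z; ring.
have Z0 : 0 <= Z by rewrite ZE; lra.
rewrite (@fsum_nat _ (Num.truncn (D * X)).+1); last first.
  move=> l lN; rewrite A10 ?(linearP0 (A2_lin _)) ?scaler0//.
  by rewrite (lt_le_trans (truncnS_gt _))// ler_nat.
rewrite (le_trans (wnorm_sum (gh_ip Wc_gh) _ _ _))//.
have term l : nrm Wc (c l *: A2 (i2 l) (A1 (i1 l) v)) <=
    M1 * M2 * Z ^+ (k + p1.*2 + p2.*2) * nrm Wa v.
  have rhs0 : 0 <= M1 * M2 * Z ^+ (k + p1.*2 + p2.*2) * nrm Wa v.
    by rewrite !mulr_ge0// ?exprn_ge0 ?wnorm_ge0.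
  have [->|c0] := eqVneq (c l) 0; first by rewrite scale0r (wnorm0 (gh_ip Wc_gh)).
  have [->|A1v] := eqVneq (A1 (i1 l) v) 0.
    by rewrite (linearP0 (A2_lin _)) scaler0 (wnorm0 (gh_ip Wc_gh)).
  have [P1l P2l] := cP l c0.
  have al := gh_ge0 Wb_gh (A1_hom l) A1v.
  have l0 : 0 <= l%:R :> R by [].
  have lD : l%:R <= D * X by lra.
  have i1Z : 1 + `|i1 l| <= Z by have := i1_le l; lra.
  have i2Z : 1 + `|i2 l| <= Z by have := i2_le l; lra.
  have sq x y p : 0 <= x -> 0 <= y -> 1 + x <= Z -> 1 + y <= Z ->
      ((1 + x) * (1 + y)) ^+ p <= Z ^+ p.*2.
    move=> x0 y0 xZ yZ; rewrite -mul2n exprM lerXn2r ?nnegrE ?exprn_ge0//.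
      by rewrite mulr_ge0// addr_ge0.
    by rewrite expr2 ler_pM// addr_ge0.
  rewrite (wnormZ (gh_ip Wc_gh)).
  have cZ : Normc.normc (c l) <= Z ^+ k.
    rewrite (le_trans (c_le l))// lerXn2r ?nnegrE ?addr_ge0//; lra.
  have A1Z : nrm Wb (A1 (i1 l) v) <= M1 * Z ^+ p1.*2 * nrm Wa v.
    rewrite (le_trans (A1_le _ _ _ P1l vt t0))// ler_wpM2r ?wnorm_ge0//.
    by rewrite ler_wpM2l// sq//; lra.
  have A2Z : nrm Wc (A2 (i2 l) (A1 (i1 l) v)) <=
      M2 * Z ^+ p2.*2 * (M1 * Z ^+ p1.*2 * nrm Wa v).
    rewrite (le_trans (A2_le _ _ _ P2l (A1_hom l) al))// ler_pM//.
    - by rewrite mulr_ge0// exprn_ge0// mulr_ge0// addr_ge0.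
    - exact: wnorm_ge0.
    - by rewrite ler_wpM2l// sq//; lra.
  rewrite (le_trans (ler_pM _ _ cZ A2Z)) ?wnorm_ge0//.
    by case: (c l) => x y; exact: sqrtr_ge0.
  by rewrite !exprD le_eqVlt; apply/orP; left; apply/eqP; ring.
apply: (@le_trans _ _ (\sum_(l < (Num.truncn (D * X)).+1)
    M1 * M2 * Z ^+ (k + p1.*2 + p2.*2) * nrm Wa v)).
  by apply: ler_sum => l _; exact: term.
rewrite sumr_const card_ord -[leLHS]mulr_natl -!addnA add1n exprS.
rewrite [leRHS](_ : _ = Z * (M1 * M2 * Z ^+ (k + (p1.*2 + p2.*2)) * nrm Wa v)); last by ring.
rewrite addnA ler_wpM2r//; first by rewrite !mulr_ge0// ?exprn_ge0 ?wnorm_ge0.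
have : (Num.truncn (D * X))%:R <= D * X by rewrite truncn_le.
by rewrite -natr1; lra.
Qed.

End Associator.

Lemma normc_sign (R : realType) (l : int) : Normc.normc ((-1) ^ l : R[i]) = 1.
Proof.
rewrite -[LHS]/(complex.Re ((Normc.normc ((-1) ^ l : R[i]))%:C)%C).
have -> : ((Normc.normc ((-1) ^ l : R[i]))%:C)%C = `|(-1) ^ l : R[i]| by [].
by case: l => k; rewrite ?exprnP ?NegzE; rewrite /exprz ?normfV normrX normrN1 expr1n ?invr1.
Qed.

Lemma poly_bounded_eq (R : realType) (V : voaData R) (Wj Wk : umodData V) P
    (A B : R -> Wj -> Wk) :
  (forall s w, A s w = B s w) -> poly_bounded P A -> poly_bounded P B.
Proof. by move=> AB; rewrite (_ : A = B)//; apply/funext => s; apply/funext. Qed.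

Section AssociatorBound.
Variables (R : realType) (V : voaData R) (U : lmodType R[i]).
Variables (yU : V -> int -> U -> U) (Wj Wk : umodData V) (y : U -> R -> Wj -> Wk).
Hypotheses (Wj_gh : graded_hilbert Wj) (Wk_gh : graded_hilbert Wk).
Hypotheses (Wj_mod : is_module Wj) (Wk_mod : is_module Wk).
Hypothesis yP : charged_field yU y.
Variables (u : V) (w : U) (d e : R) (n : int) (P : set R).
Hypothesis uj_shift : forall m t v, hom Wj t v ->
  hom Wj (t + (e - m%:~R - 1)) (mod_Y u m v).
Hypothesis uk_shift : forall m t v, hom Wk t v ->
  hom Wk (t + (e - m%:~R - 1)) (mod_Y u m v).
Hypothesis w_shift : weight_shift (fun s => d - s - 1) (y w).

(** In each term l cancels between the two mode indices, so all terms shift weights equally. *)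
Lemma associator_shift :
  weight_shift (fun s => (d + e - n%:~R - 1) - s - 1) (y (yU u n w)).
Proof.
have prk := gh_sum Wk_gh.
move=> s t v vt; rewrite (jacobi_associator (cf_jacobi yP)).
have sub := subspace_component prk (t + (d + e - n%:~R - 1 - s - 1)).
apply: (subspaceB sub); apply: (fsum_subspace sub) => l; apply: (subspaceZ _ sub).
  have := uk_shift (n - l%:Z) (w_shift (s + l%:R) vt).
  by rewrite rmorphB /=; congr (hom _ _ _); ring.
have := w_shift (n%:~R + s - l%:R) (uj_shift l%:Z vt).
by congr (hom _ _ _); rewrite -pmulrn; ring.
Qed.

Hypothesis w_bounded : poly_bounded setT (y w).
Hypothesis uj_bounded : poly_bounded P (real_modes (W := Wj) u).
Hypothesis uk_bounded : poly_bounded P (real_modes (W := Wk) u).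
Hypothesis binzP : forall l, binz R n l != 0 -> P l%:R /\ P (n - l%:Z)%:~R.

(** Bounds on the field of u are required only at modes with a nonzero coefficient: [P] is
    everything in general, and the set of 0, 1, 2 when u is the conformal vector and n = 2. *)
Lemma associator_bounded : poly_bounded setT (y (yU u n w)).
Proof.
(* [D] is chosen so that D X, with X = (1 + |s|)(1 + t), dominates all indices and weights at l =
   0. *)
pose D := 3 + `|d| + `|e| + `|n%:~R|.
have D1 : 1 <= D.
  by rewrite /D; have := normr_ge0 d; have := normr_ge0 e; have := normr_ge0 (n%:~R : R); lra.
have estimates (s t : R) : 0 <= t -> let X := (1 + `|s|) * (1 + t) in
    1 <= X /\ 1 + t + `|s| + `|d| + `|e| + `|n%:~R| <= D * X.
  move=> t0 X; have X1 : 1 + t + `|s| <= X.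
    by rewrite /X; have := mulr_ge0 (normr_ge0 s) t0; lra.
  have := normr_ge0 d; have := normr_ge0 e; have := normr_ge0 (n%:~R : R).
  have := normr_ge0 s; rewrite /D; split; first by lra.
  by have := normr_ge0 (n%:~R : R); nra.
have [M [p [M0 yle]]] := w_bounded.
have poly M' q : 0 <= M' -> forall s t : R, M' * ((2 * D + 1) * ((1 + `|s|) * (1 + t))) ^+ q =
    M' * (2 * D + 1) ^+ q * ((1 + `|s|) * (1 + t)) ^+ q.
  by move=> _ s t; rewrite exprMn mulrA.
(* Both sums are written as compositions of real-indexed fields, so that [wnorm_fsum_comp_le]
   applies to each. *)
apply: (@poly_bounded_eq _ _ _ _ _ (fun s v => - 1 *:
   (\sum_(l \in [set: nat]) ((-1) ^ (l%:Z + n) * binz R n l) *: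
       y w (n%:~R + s - l%:R) (real_modes u l%:R v)) +
   \sum_(l \in [set: nat]) ((-1) ^+ l * binz R n l) *:
     real_modes u (n - l%:Z)%:~R (y w (s + l%:R) v))).
  move=> s v; rewrite (jacobi_associator (cf_jacobi yP)) scaleN1r addrC.
  congr (_ - _); apply: eq_fsbigr => l _; first by rewrite real_modes_int.
  by rewrite -(real_modes_int u l%:Z).
have coef (z : R[i]) l : Normc.normc z = 1 ->
    Normc.normc (z * binz R n l) <= (1 + l%:R) ^+ `|n|%N.
  by move=> z1; rewrite Normc.normcM z1 mul1r normc_binz_le.
have coef0 (z : R[i]) l : z * binz R n l != 0 -> binz R n l != 0.
  by apply: contraNneq => ->; rewrite mulr0.
apply: (poly_boundedZD Wk_gh).
- have [M' [p' [M'0 ule]]] := uj_bounded.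
  exists (M' * M * (2 * D + 1) ^+ (1 + `|n| + p'.*2 + p.*2)), (1 + `|n| + p'.*2 + p.*2)%N.
  split; first by rewrite !mulr_ge0// exprn_ge0//; lra.
  move=> s t v _ vt t0; have [X1 DX] := estimates s t t0.
  rewrite -poly ?mulr_ge0//.
  have := normr_ge0 s; have := normr_ge0 (n%:~R : R).
  have := normr_ge0 e; have := ler_norm e; have := normr_ge0 d => d0 el e0 n0 s0.
  (* The inner operator is the mode l of u, which yields weight t + e - 1 - l. *)
  apply: (wnorm_fsum_comp_le Wj_gh Wk_gh (P1 := P) (P2 := setT) (a := t + e - 1) (t := t)) => //.
  + by move=> r; exact: charged_field_linear yP _ _.
  + by move=> l; apply: coef; rewrite normc_sign.
  + move=> l; rewrite ger0_norm//; have := ler0n R l; lra.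
  + move=> l; have := ler_normB (n%:~R + s) l%:R; have := ler_normD n%:~R s.
    by rewrite (ger0_norm (ler0n R l)); lra.
  + by lra.
  + by lra.
  + move=> l; have := uj_shift l%:Z vt; rewrite -real_modes_int.
    by congr (hom _ _ _); rewrite -pmulrn; ring.
  + by move=> l /coef0/binzP[].
have [M' [p' [M'0 ule]]] := uk_bounded.
exists (M * M' * (2 * D + 1) ^+ (1 + `|n| + p.*2 + p'.*2)), (1 + `|n| + p.*2 + p'.*2)%N.
split; first by rewrite !mulr_ge0// exprn_ge0//; lra.
move=> s t v _ vt t0; have [X1 DX] := estimates s t t0.
rewrite -poly ?mulr_ge0//.
have := normr_ge0 s; have := normr_ge0 (n%:~R : R); have := ler_norm (- s).
have := normr_ge0 e; have := ler_norm d; have := normr_ge0 d.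
rewrite normrN => d0 dl e0 sl n0 s0.
(* The inner operator is now the mode s + l of the field of w, which yields weight t + d - s - 1 -
   l. *)
apply: (wnorm_fsum_comp_le Wk_gh Wk_gh (P1 := setT) (P2 := P) (a := t + d - s - 1) (t := t)) => //.
+ by move=> r; exact: real_modes_linear (mod_weak Wk_mod) _ _.
+ by move=> l; apply: coef; rewrite exprnP normc_sign.
+ move=> l; have := ler_normD s l%:R; rewrite (ger0_norm (ler0n R l)); lra.
+ move=> l; have := ler_normB n%:~R (l%:R : R); rewrite (ger0_norm (ler0n R l)).
  by rewrite rmorphB /=; lra.
+ by lra.
+ by lra.
+ by move=> l; have := w_shift (s + l%:R) vt; congr (hom _ _ _); ring.
+ by move=> l /coef0/binzP[].
Qed.

End AssociatorBound.

Section Reparametrization.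
Variables (R : realType) (V : voaData R) (Wj Wk : umodData V).
Implicit Types (A : R -> Wj -> Wk).

(** Since 1 + |c - s| <= (1 + |c|)(1 + |s|), reversing and translating the modes costs only a
    constant. *)
Lemma poly_bounded_reflect A (c : R) :
  poly_bounded setT A -> poly_bounded setT (fun s => A (c - s)).
Proof.
move=> [M [p [M0 Ale]]]; exists (M * (1 + `|c|) ^+ p), p; split.
  by rewrite mulr_ge0// exprn_ge0// addr_ge0.
move=> s t w _ wt t0; rewrite (le_trans (Ale _ t w I wt t0))//.
rewrite ler_wpM2r ?wnorm_ge0// -mulrA ler_wpM2l// -exprMn mulrA.
rewrite lerXn2r ?nnegrE ?mulr_ge0 ?addr_ge0// ler_wpM2r ?addr_ge0//.
have := ler_normB c s; have := mulr_ge0 (normr_ge0 c) (normr_ge0 s); lra.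
Qed.

Lemma energy_bounds_reflect A (c r : R) :
  energy_bounds r A -> energy_bounds r (fun s => A (c - s)).
Proof.
move=> [M [t [M0 t0 Ale]]]; exists (M * (1 + `|c|) `^ t), t.
split=> [||s w]; rewrite ?mulr_ge0 ?powR_ge0//.
rewrite (le_trans (Ale _ _))// ler_wpM2r ?wnorm_ge0// -mulrA ler_wpM2l//.
rewrite -powRM ?addr_ge0//; apply: powR_le_base; rewrite ?addr_ge0//.
have := ler_normB c s; have := mulr_ge0 (normr_ge0 c) (normr_ge0 s); lra.
Qed.

End Reparametrization.

Lemma poly_bounded_subspace (R : realType) (V : voaData R) (U : lmodType R[i])
    (yU : V -> int -> U -> U) (Wj Wk : umodData V) (y : U -> R -> Wj -> Wk) :
  graded_hilbert Wk -> charged_field yU y ->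
  Defs.subspace [set w | poly_bounded setT (y w)].
Proof.
move=> Wk_gh yP; split=> [|a w w' /= w_bd w'_bd].
  apply: (@poly_bounded_eq _ _ _ _ _ (fun _ _ => 0)); last exact: poly_bounded0.
  by move=> s v; rewrite (linearP0 (charged_field_linear_charge yP _ _)).
apply: poly_bounded_eq (poly_boundedZD Wk_gh a w_bd w'_bd) => s v.
by rewrite (charged_field_linear_charge yP).
Qed.

(** * Energy bounds from generators and from a single vector of an irreducible module *)

Section UnitaryIntertwining.
Variables (R : realType) (V : voaData R) (V_voa : is_voa V).
Variables (theta : V -> V) (theta_nu : theta (conf V) = conf V).

Lemma module_shift (W : modData V) (k : int) u : is_module W ->
  component (@voa_pr _ V) k u -> forall m t v, hom W t v ->
  hom W (t + (k%:~R - m%:~R - 1)) (mod_Y u m v).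
Proof.
move=> W_mod uk m t v vt; rewrite -real_modes_int.
apply: (charged_field_shift W_mod W_mod (real_modes_charged (mod_weak W_mod))) vt.
by rewrite -[LHS]/(vL 0 u) (voa_L0 V_voa uk) rmorph_int.
Qed.

Lemma real_modes_shift (W : umodData V) (k : int) u : is_module W ->
  component (@voa_pr _ V) k u ->
  weight_shift (fun s => k%:~R - s - 1) (real_modes (W := W) u).
Proof.
move=> W_mod uk s t v vt.
apply: (charged_field_shift W_mod W_mod (real_modes_charged (mod_weak W_mod))) vt.
by rewrite -[LHS]/(vL 0 u) (voa_L0 V_voa uk) rmorph_int.
Qed.

(** Induction on the length of a product of modes applied to the vacuum, each step being one use of
    the associator; polynomial bounds then extend to the span. *)
Lemma generated_energy_bounded (W : umodData V) (W_unitary : unitary_module theta W)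
    (E : set V) :
  (forall v, E v -> homogeneous (@voa_pr R V) v) -> generated_by E ->
  (forall v, E v -> energy_bounded (real_modes (W := W) v)) ->
  mod_energy_bounded W.
Proof.
move=> E_hom E_gen E_bd.
have W_gh := unitary_graded_hilbert V_voa theta_nu W_unitary.
have W_mod := umod_module W_unitary; have W_weak := mod_weak W_mod.
have RM := real_modes_charged W_weak.
have products (p : seq (V * int)) : (forall q, q \in p -> E q.1) ->
    let v := foldr (fun q u => voa_Y q.1 q.2 u) (vac V) p in
    (exists d, weight_shift (fun s => d - s - 1) (real_modes (W := W) v)) /\
    poly_bounded setT (real_modes (W := W) v).
  elim: p => [_|[v n] p IHp pE] /=.
    (* The vacuum field is the identity at mode -1 and zero elsewhere, so it starts the induction
       with d = 0. *)
    have vacE s w : real_modes (vac V) s w = if s == -1 then w else 0 :> W.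
      have [/intrP[k ->]|sN] := boolP (s \is a Num.int).
        rewrite real_modes_int (mod_vacuum W_weak).
        by rewrite -[-1 in RHS](rmorphN1 intr) eqr_int.
      rewrite real_modes_nint//; case: eqP sN => // ->.
      by rewrite rpredN rpred1.
    split.
      exists 0 => s t w wt; rewrite vacE; case: eqP => [->|_].
        by rewrite opprK add0r subrr addr0.
      by case: (subspace_component (gh_sum W_gh) (t + (0 - s - 1))).
    exists 1, 0%N; split=> // s t w _ wt t0; rewrite vacE expr0 !mul1r.
    by case: eqP => // _; rewrite (wnorm0 (gh_ip W_gh)) wnorm_ge0.
  have [|[d p_shift] p_bd] := IHp.
    by move=> q qp; apply: pE; rewrite inE qp orbT.
  have Ev : E v by apply: (pE (v, n)); rewrite inE eqxx.
  have [k vk] := E_hom v Ev.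
  have shift := module_shift W_mod vk.
  have [r r0 /(energy_bounds_poly W_gh) v_bd] := E_bd v Ev.
  split.
    exists (d + k%:~R - n%:~R - 1).
    exact: (associator_shift W_gh RM n shift shift p_shift).
  exact: (associator_bounded W_gh W_gh W_mod RM shift p_shift p_bd v_bd v_bd
    (fun l _ => conj I I)).
have all_bd v : poly_bounded setT (real_modes (W := W) v).
  apply: (lspan_full_ind E_gen (poly_bounded_subspace W_gh RM)) => {v} v [p pE ->].
  by case: (products p pE).
move=> v [k vk].
apply: (poly_energy_bounded W_gh W_gh _ (real_modes_shift W_mod vk) (all_bd v)).
by move=> s; exact: real_modes_linear.
Qed.

Variables (Wi Wj Wk : umodData V).
Hypotheses (Wi_unitary : unitary_module theta Wi).
Hypotheses (Wj_unitary : unitary_module theta Wj).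
Hypotheses (Wk_unitary : unitary_module theta Wk).
Variables (alpha : Wi -> R -> Wj -> Wk) (alpha_itw : intertwining alpha).
Let Wi_mod := umod_module Wi_unitary.
Let Wj_mod := umod_module Wj_unitary.
Let Wk_mod := umod_module Wk_unitary.
Let Wi_gh := unitary_graded_hilbert V_voa theta_nu Wi_unitary.
Let Wj_gh := unitary_graded_hilbert V_voa theta_nu Wj_unitary.
Let Wk_gh := unitary_graded_hilbert V_voa theta_nu Wk_unitary.

Lemma intertwining_charged : charged_field (@mod_Y _ _ Wi) alpha.
Proof.
split; [exact: itw_bilinear alpha_itw| |exact: itw_jacobi alpha_itw].
exact: (itw_derivative alpha_itw).
Qed.
Let alphaP := intertwining_charged.

Lemma intertwining_linear w s : linear (alpha w s).
Proof. exact: (charged_field_linear alphaP). Qed.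

Lemma intertwining_shift d w : hom Wi d w ->
  weight_shift (fun s => d - s - 1) (alpha w).
Proof.
move=> wd s t v; apply: (charged_field_shift Wj_mod Wk_mod alphaP).
exact: (mod_L0 Wi_mod wd).
Qed.

(** The span of the vectors whose fields shift weights and are polynomially bounded is a nonzero
    submodule of [Wi], hence everything. *)
Lemma irreducible_energy_bounded : irreducible_module Wi ->
  mod_energy_bounded Wj -> mod_energy_bounded Wk ->
  (exists w : Wi, [/\ w != 0, homogeneous (@mod_pr R V Wi) w &
                      energy_bounded (alpha w)]) ->
  itw_energy_bounded alpha.
Proof.
move=> [_ _ Wi_irr] Yj_bd Yk_bd [w0 [w0_neq0 [d0 w0d] [r0 _ /(energy_bounds_poly Wj_gh) w0_bd]]].
(* A sum of vectors with different shifts need not shift weights, so [A] need not be a subspace and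
   its span is used. *)
pose A : set Wi := [set w | (exists d, weight_shift (fun s => d - s - 1) (alpha w)) /\
  poly_bounded setT (alpha w)].
have w0A : lspan A w0.
  by apply: sub_lspan; split=> //; exists d0; exact: intertwining_shift.
have A_submodule : submodule (@mod_Y _ _ Wi) (lspan A).
  split; first exact: subspace_lspan.
  move=> v n w; case: (mod_bilinear (mod_weak Wi_mod)) => Y_lin Y_lin_charge.
  move=> /(_ [set w | lspan A (mod_Y v n w)]); apply.
    split=> [|a w1 w2 /= Aw1 Aw2].
      by rewrite /= (linearP0 (Y_lin _ _)); case: (subspace_lspan A).
    by rewrite Y_lin; case: (subspace_lspan A) => _; apply.
  move=> {}w [[d w_shift] w_bd] /=.
  have prV : direct_sum_decomposition (@voa_pr _ V) by case: (voa_grading V_voa).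
  (* The associator bound needs u homogeneous, so v is split into its components. *)
  have [r [_ _ ->]] := pr_decomposition prV v.
  rewrite (linearP_sum (Y_lin_charge _ _)).
  apply: (subspace_sum _ (subspace_lspan A)) => k _; apply: sub_lspan.
  have vk := component_pr prV k v.
  have shiftj := module_shift Wj_mod vk; have shiftk := module_shift Wk_mod vk.
  have vhom : homogeneous (@voa_pr _ V) (voa_pr k v) by exists k.
  have [rj _ /(energy_bounds_poly Wj_gh) bdj] := Yj_bd _ vhom.
  have [rk _ /(energy_bounds_poly Wk_gh) bdk] := Yk_bd _ vhom.
  split.
    exists (d + k%:~R - n%:~R - 1).
    exact: (associator_shift Wk_gh alphaP n shiftj shiftk w_shift).
  exact: (associator_bounded Wj_gh Wk_gh Wk_mod alphaP shiftj w_shift w_bd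
    bdj bdk (fun l _ => conj I I)).
have A_full : lspan A = setT.
  case: (Wi_irr _ A_submodule) => // A0.
  by move: w0A; rewrite A0 /= => w00; rewrite w00 eqxx in w0_neq0.
have all_bd w : poly_bounded setT (alpha w).
  by apply: (lspan_full_ind A_full (poly_bounded_subspace Wk_gh alphaP)) => {}w [].
move=> w [d wd].
apply: (poly_energy_bounded Wj_gh Wk_gh _ (intertwining_shift wd) (all_bd w)).
exact: intertwining_linear.
Qed.

(** * The opposite field, and the conjugate, transposed and adjoint intertwining operators *)

Section Opposite.
Variables (d : R) (w : Wi) (wd : hom Wi d w).
Local Notation L1 := (@mL _ _ Wi 1).

Lemma L1_hom t v : hom Wi t v -> hom Wi (t - 1) (L1 v).
Proof.
move=> vt; have := conf_shift V_voa Wi_unitary 2 vt.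
by rewrite (_ : 1 - 2%:~R = - 1 :> R)//; ring.
Qed.

Lemma iter_L1_hom l : hom Wi (d - l%:R) (iter l L1 w).
Proof.
elim: l => [|l IHl]; first by rewrite subr0.
by rewrite -natr1 opprD addrA; exact: L1_hom.
Qed.

Lemma iter_L1_eq0 l : d < l%:R -> iter l L1 w = 0.
Proof.
move=> dl; apply/eqP; apply: contraTT isT => Lw.
by have := gh_ge0 Wi_gh (iter_L1_hom l) Lw; lra.
Qed.

(** Weights being nonnegative, L_1^l w = 0 for l > d; this cutoff depends on neither s nor the
    vector acted on. *)
Let N := (Num.bound `|d|).

Lemma opposite_modesE plus s v :
  opposite_modes (@mod_pr _ _ Wi) L1 (@pi_phase R plus) alpha w s v =
  \sum_(l < N) (pi_phase plus d / (l`!)%:R) *: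
    alpha (iter l L1 w) ((2 * d - l%:R - 2) - s) v.
Proof.
have alpha0 s' : alpha 0 s' v = 0.
  exact: (linearP0 (charged_field_linear_charge alphaP _ _)).
have iter0 l : iter l L1 0 = 0.
  elim: l => //= l ->; case: (mod_bilinear (mod_weak Wi_mod)) => H _.
  exact: (linearP0 (H _ _)).
rewrite /opposite_modes (@fsum_only _ _ d) => [|d' dd']; last first.
  rewrite fsbig1// => l _; rewrite (pr_component_neq (gh_sum Wi_gh) wd dd').
  by rewrite iter0 alpha0 scaler0.
rewrite wd (@fsum_nat _ N) => [|l Nl]; last first.
  rewrite iter_L1_eq0 ?alpha0 ?scaler0//.
  rewrite (le_lt_trans (ler_norm _))// (lt_le_trans (archi_boundP _))//.
  by rewrite ler_nat.
by apply: eq_bigr => l _; congr (_ *: alpha _ _ _); ring.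
Qed.

Local Notation opp plus :=
  (opposite_modes (@mod_pr _ _ Wi) L1 (@pi_phase R plus) alpha w).

Lemma opposite_linear plus s : linear (opp plus s).
Proof.
move=> a u v; rewrite !opposite_modesE scaler_sumr -big_split /=.
apply: eq_bigr => l _; rewrite intertwining_linear scalerDr !scalerA.
by rewrite [a * _]mulrC.
Qed.

Lemma opposite_shift plus : weight_shift (fun s => s + 1 - d) (opp plus).
Proof.
move=> s t v vt; rewrite opposite_modesE.
have sub := subspace_component (gh_sum Wk_gh) (t + (s + 1 - d)).
apply: (subspace_sum _ sub) => l _; apply: (subspaceZ _ sub).
have := intertwining_shift (iter_L1_hom l) (2 * d - l%:R - 2 - s) vt.
by congr (hom _ _ _); ring.
Qed.

Lemma normc_pi_phase plus : Normc.normc (pi_phase plus d) = 1.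
Proof. by rewrite /pi_phase /Normc.normc cos2Dsin2 sqrtr1. Qed.

(* For n = 2 the associator only involves the modes 0, 1, 2 of nu. *)
Lemma iter_L1_poly_bounded l : poly_bounded setT (alpha w) ->
  poly_bounded setT (alpha (iter l L1 w)).
Proof.
move=> w_bd; elim: l => //= l IHl.
have nu2 := voa_conf_weight V_voa.
apply: (@associator_bounded _ _ _ _ _ _ _ Wj_gh Wk_gh Wk_mod alphaP (conf V)
  (iter l L1 w) (d - l%:R) 2 2 [set 0; 1; 2]).
- exact: (module_shift Wj_mod nu2).
- exact: intertwining_shift (iter_L1_hom l).
- exact: IHl.
- exact: (conf_poly_bounded V_voa theta_nu Wj_unitary).
- exact: (conf_poly_bounded V_voa theta_nu Wk_unitary).
case=> [|[|[|m]]]; last by rewrite (binz_nat _ 2) bin_small// eqxx.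
- by split; [left; left|right].
- by split; left; right.
- by split; [right|left; left].
Qed.

(** The opposite field is a fixed finite combination of reflected fields of L_1^l w; the order of
    the bounds may change. *)
Lemma opposite_energy_bounded plus : energy_bounded (alpha w) ->
  energy_bounded (opp plus).
Proof.
move=> [r r0 /(energy_bounds_poly Wj_gh) w_bd].
apply: (poly_energy_bounded Wj_gh Wk_gh (opposite_linear plus) (@opposite_shift plus)).
pose F l := fun s v => (pi_phase plus d / (l`!)%:R) *:
  alpha (iter l L1 w) ((2 * d - l%:R - 2) - s) v.
suff H n : poly_bounded setT (fun s v => \sum_(l < n) F l s v).
  apply: poly_bounded_eq (H N) => s v; by rewrite opposite_modesE.
elim: n => [|n IHn].
  apply: (@poly_bounded_eq _ _ _ _ _ (fun _ _ => 0)); last exact: poly_bounded0.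
  by move=> s v; rewrite big_ord0.
have := poly_boundedZD Wk_gh (pi_phase plus d / (n`!)%:R)
  (poly_bounded_reflect (2 * d - n%:R - 2) (iter_L1_poly_bounded n w_bd)) IHn.
by apply: poly_bounded_eq => s v; rewrite big_ord_recr addrC.
Qed.

(** Only l = 0 contributes, with a phase of modulus 1, so the opposite field is a reflection of the
    original one and has the same order. *)
Lemma quasi_primary_opposite_bounds plus r : mL 1 w = 0 ->
  energy_bounds r (alpha w) -> energy_bounds r (opp plus).
Proof.
move=> Lw /(energy_bounds_reflect (2 * d - 2))[M [t [M0 t0 wle]]].
exists M, t; split=> // s v.
rewrite (_ : opp plus s v = pi_phase plus d *: alpha w (2 * d - 2 - s) v).
  by rewrite (wnormZ (gh_ip Wk_gh)) normc_pi_phase mul1r.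
have alpha0 s' : alpha 0 s' v = 0.
  exact: (linearP0 (charged_field_linear_charge alphaP _ _)).
have iterS0 l : iter l.+1 L1 w = 0.
  elim: l => //= l ->; case: (mod_bilinear (mod_weak Wi_mod)) => H _.
  exact: (linearP0 (H _ _)).
(* The bound lies strictly above |d| >= 0, so the term l = 0 does occur in the sum. *)
have N_gt0 : (0 < N)%N.
  by rewrite -(ltr_nat R); apply: (le_lt_trans (normr_ge0 d)); exact: archi_boundP.
rewrite opposite_modesE; case: (N) N_gt0 => // m _.
rewrite big_ord_recl big1 => [|l _]; last by rewrite iterS0 alpha0 scaler0.
by rewrite addr0 fact0 divr1 subr0.
Qed.

Lemma opposite_adjoint_bounds plus r : 0 <= r -> energy_bounds r (opp plus) ->
  energy_bounds r (fun s => adjoint (opp plus s)).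
Proof.
move=> r0; apply: (energy_bounds_adjoint Wj_gh Wk_gh (opposite_linear plus)
  (@opposite_shift plus) (c := 1 + `|d|)) => // s.
rewrite (le_trans (ler_normB _ _))// (le_trans (lerD (ler_normD _ _) (lexx _)))//.
by rewrite normr1; lra.
Qed.

Lemma itw_C_bounds plus r : 0 <= r -> energy_bounds r (opp plus) ->
  energy_bounds r (itw_C plus alpha w).
Proof.
move=> r0 /(opposite_adjoint_bounds r0).
exact: (energy_bounds_transpose Wj_gh Wk_gh (opposite_linear plus) (@opposite_shift plus)).
Qed.

Lemma itw_adj_bounds r : 0 <= r -> energy_bounds r (opp true) ->
  energy_bounds r (itw_adj alpha (conj_map w)).
Proof.
by move=> r0 /(opposite_adjoint_bounds r0); rewrite /itw_adj (conj_mapK Wi_gh).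
Qed.

Lemma itw_bar_bounds r : energy_bounds r (alpha w) ->
  energy_bounds r (itw_bar alpha (conj_map w)).
Proof.
by move=> /(energy_bounds_conj Wj_gh Wk_gh); rewrite /itw_bar (conj_mapK Wi_gh).
Qed.

End Opposite.

End UnitaryIntertwining.

Theorem corollary3p7 (R : realType)
    (V : voaData R) (ipV : V -> V -> R[i]) (theta : V -> V)
    (V_voa : is_voa V)
    (V_unitary : unitary_voa ipV theta)
    (V_cft : cft_type V)
    (V_c2 : c2_cofinite V)
    (V_rational : N_gradable_modules_completely_reducible V)
    (Wi Wj Wk : umodData V)
    (Wi_unitary : unitary_module theta Wi)
    (Wj_unitary : unitary_module theta Wj)
    (Wk_unitary : unitary_module theta Wk)
    (alpha : Wi -> R -> Wj -> Wk)
    (alpha_itw : intertwining alpha) :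
  [/\ (* (a) *)
      forall E : set V,
        (forall v, E v -> homogeneous (@voa_pr R V) v) ->
        generated_by E ->
        (forall v, E v -> energy_bounded (real_modes (W := Wi) v)) ->
        mod_energy_bounded Wi,
      (* (b) *)
      irreducible_module Wi ->
        mod_energy_bounded Wj -> mod_energy_bounded Wk ->
        (exists w : Wi, [/\ w != 0, homogeneous (@mod_pr R V Wi) w &
                            energy_bounded (alpha w)]) ->
        itw_energy_bounded alpha,
      (* (c) *)
      forall w : Wi, homogeneous (@mod_pr R V Wi) w -> energy_bounded (alpha w) ->
        [/\ forall plus : bool, energy_bounded (itw_C plus alpha w),
            energy_bounded (itw_bar alpha (conj_map w)) &
            energy_bounded (itw_adj alpha (conj_map w))] &
      (* (d) *)
      forall (w : Wi) (r : R), quasi_primary w -> 0 <= r ->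
        energy_bounds r (alpha w) ->
        [/\ forall plus : bool, energy_bounds r (itw_C plus alpha w),
            energy_bounds r (itw_bar alpha (conj_map w)) &
            energy_bounds r (itw_adj alpha (conj_map w))]].
Proof.
have theta_nu : theta (conf V) = conf V := theta_conf (uvoa_theta V_unitary).
split.
- by move=> E; exact: (generated_energy_bounded V_voa theta_nu Wi_unitary).
- exact: (irreducible_energy_bounded V_voa theta_nu Wi_unitary).
- move=> w [d wd] w_bd.
  (* Part (c) accepts any order for the opposite field; transposes and adjoints then preserve that
     order. *)
  have opp_bd plus := opposite_energy_bounded V_voa theta_nu Wi_unitary Wj_unitary
    Wk_unitary alpha_itw wd plus w_bd.
  split.
  + move=> plus; have [r r0 bd] := opp_bd plus; exists r => //.
    exact: (itw_C_bounds V_voa theta_nu Wi_unitary Wj_unitary Wk_unitary alpha_itw wd).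
  + have [r r0 bd] := w_bd; exists r => //.
    exact: (itw_bar_bounds V_voa theta_nu Wi_unitary Wj_unitary Wk_unitary).
  + have [r r0 bd] := opp_bd true; exists r => //.
    exact: (itw_adj_bounds V_voa theta_nu Wi_unitary Wj_unitary Wk_unitary alpha_itw wd).
move=> w r [[d wd] Lw] r0 w_bd.
(* For part (d) the opposite field must keep the order r, which is where quasi-primarity enters. *)
have opp_bd plus : energy_bounds r (opposite_modes (@mod_pr _ _ Wi) (mL 1)
    (@pi_phase R plus) alpha w).
  exact: (quasi_primary_opposite_bounds V_voa theta_nu Wi_unitary Wk_unitary alpha_itw wd).
split.
- move=> plus.
  exact: (itw_C_bounds V_voa theta_nu Wi_unitary Wj_unitary Wk_unitary alpha_itw wd).
- exact: (itw_bar_bounds V_voa theta_nu Wi_unitary Wj_unitary Wk_unitary).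
- exact: (itw_adj_bounds V_voa theta_nu Wi_unitary Wj_unitary Wk_unitary alpha_itw wd).
Qed.
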